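(* Let $S$ be an embeddable monoid and let $\mathbf{\Gamma}=(\Gamma,\gamma)$ be a realization of the free $S$-group. Let $S$ act continuously on a compact metric space $X$. If $\mathcal{P}(X_{\mathbf{\Gamma}},\Gamma)$ (resp. $\mathcal{P}^{\mathrm{erg}}(X_{\mathbf{\Gamma}},\Gamma)$) is weak-* dense in $\mathcal{M}_\Gamma(X_{\mathbf{\Gamma}})$, then $$\operatorname{Ext}_{\mathbf{\Gamma}}(X,S)=\overline{\mathcal{P}(X,S)}\qquad\text{(resp. }\operatorname{Ext}_{\mathbf{\Gamma}}(X,S)=\overline{\mathcal{P}^{\mathrm{erg}}(X,S)}\text{)},$$ where the bar denotes weak-* closure. In particular, if (i) $\Gamma$ has the PA property (resp. the EPA property), and (ii) $\operatorname{Ext}_{\mathbf{\Gamma}}(\mathcal{A}^S,S)=\mathcal{M}_S(\mathcal{A}^S)$ for every finite alphabet $\mathcal{A}$, then $S$ has the PA property (resp. the EPA property).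
   Context: All semigroups are countable and discrete. An action of a monoid $S$ satisfies $s\cdot(t\cdot x)=(st)\cdot x$ and $1_S\cdot x=x$; it is continuous if each map $x\mapsto s\cdot x$ is continuous. $S$-groups. An $S$-group is a pair $(G,\eta)$ with $G$ a group and $\eta\colon S\to G$ a semigroup morphism such that $\eta(S)$ generates $G$ as a group; it is a receiving $S$-group if $\eta$ is injective. $S$ is embeddable if it admits an injective semigroup morphism into a group. A free $S$-group is an $S$-group $(\Gamma,\gamma)$ such that for every $S$-group $(G,\eta)$ there is a unique group morphism $\theta\colon\Gamma\to G$ with $\theta\circ\gamma=\eta$; it is unique up to isomorphism, and any such pair is called a realization of the free $S$-group. If $S$ is embeddable, then $\gamma$ is injective. Natural extension. For a receiving $S$-group $\mathbf{G}=(G,\eta)$ and a continuous action of $S$ on a compact metric space $X$, let $X_{\mathbf{G}}=\{(x_h)_{h\in G}\in X^G: s\cdot x_h=x_{\eta(s)h}\ \forall s\in S,h\in G\}$ with the subspace topology of the product topology, with the shift action of $G$ given by $(g\cdot \bar x)_h=\bar x_{hg}$, and let $\pi\colon X_{\mathbf{G}}\to X$, $\pi((x_h)_h)=x_{1_G}$. Measures. $\mathcal{M}(X)$ is the set of Borel probability measures on $X$ with the weak-* topology; $\mathcal{M}_S(X)$ is the subset of $S$-invariant ones ($\mu(s^{-1}A)=\mu(A)$ for all $s\in S$ and Borel $A$, where $s^{-1}A=\{x:s\cdot x\in A\}$). $\mu\in\mathcal{M}_S(X)$ is ergodic if every Borel $A$ with $\mu(s^{-1}A\triangle A)=0$ for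 all $s\in S$ has $\mu(A)\in\{0,1\}$. $\mathcal{P}(X,S)$ is the set of $\mu\in\mathcal{M}_S(X)$ with finite support, and $\mathcal{P}^{\mathrm{erg}}(X,S)$ the set of ergodic elements of $\mathcal{P}(X,S)$; the same notation is used for $\Gamma$ acting on $X_{\mathbf{\Gamma}}$. The push-forward $\pi_*\colon\mathcal{M}_G(X_{\mathbf{G}})\to\mathcal{M}_S(X)$ is $\pi_*\bar\mu(A)=\bar\mu(\pi^{-1}A)$, and $\operatorname{Ext}_{\mathbf{G}}(X,S)=\operatorname{im}(\pi_* )$. For a finite alphabet $\mathcal{A}$ (discrete), $\mathcal{A}^S$ has the product topology and shift action $(s\cdot x)(t)=x(ts)$. A semigroup $S$ has the PA property (resp. EPA property) if $\mathcal{P}(\mathcal{A}^S,S)$ (resp. $\mathcal{P}^{\mathrm{erg}}(\mathcal{A}^S,S)$) is weak-* dense in $\mathcal{M}_S(\mathcal{A}^S)$ for every finite alphabet $\mathcal{A}$; the same definition applies to groups. *)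

(* Defs.v *)
From HB Require Import structures.
From mathcomp Require Import all_boot all_algebra.
From mathcomp Require Import all_classical all_reals all_analysis.

Set Implicit Arguments.
Unset Strict Implicit.
Unset Printing Implicit Defensive.

Import numFieldNormedType.Exports.

Local Open Scope classical_set_scope.
Local Open Scope ring_scope.

Section SGroups.
Local Open Scope group_scope.

Definition is_subgroup (G : groupType) (H : set G) : Prop :=
  H 1 /\ (forall x y, H x -> H y -> H (x * y)) /\ (forall x, H x -> H x^-1).

Definition is_Sgroup (S : semigroupType) (G : groupType)
    (eta : {multiplicative S -> G}) : Prop :=
  smallest (@is_subgroup G) (range eta) = [set: G].

Definition embeddable (S : semigroupType) : Prop :=
  exists (G : groupType) (eta : {multiplicative S -> G}), injective eta.

Definition is_free_Sgroup (S : semigroupType) (Gamma : groupType)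
    (gamma : {multiplicative S -> Gamma}) : Prop :=
  is_Sgroup gamma /\
  forall (G : groupType) (eta : {multiplicative S -> G}), is_Sgroup eta ->
    exists theta : {multiplicative Gamma -> G},
      theta \o gamma =1 eta /\
      forall theta' : {multiplicative Gamma -> G},
        theta' \o gamma =1 eta -> theta' =1 theta.

Definition is_action (S : monoidType) (X : Type) (act : S -> X -> X) : Prop :=
  (forall s t x, act (s * t) x = act s (act t x)) /\
  (forall x, act 1 x = x).

Definition is_continuous_action (S : monoidType) (X : topologicalType)
    (act : S -> X -> X) : Prop :=
  is_action act /\ forall s, continuous (act s).

End SGroups.

(* The library's measurable spaces are pointed, whereas the spaces considered
   here (natural extensions in particular) may be empty. An empty space carries
   no probability, so a Borel probability on T is a proof that T is inhabited
   together with a probability on T pointed by that proof; the point itself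
   plays no role. *)
Definition pointed_by (T : Type) (h : inhabited T) : Type := T.

Lemma inhabited_ex (T : Type) : inhabited T -> exists _ : T, True.
Proof. by case=> x; exists x. Qed.

HB.instance Definition _ (T : choiceType) (h : inhabited T) :=
  Choice.on (pointed_by h).
HB.instance Definition _ (T : choiceType) (h : inhabited T) :=
  isPointed.Build (pointed_by h) (projT1 (cid (inhabited_ex h))).

Definition borel_type (T : topologicalType) (h : inhabited T) :=
  @g_sigma_algebraType (pointed_by h) (@open T).

(* Equal to the measurable sets of borel_type h, for every h. *)
Definition Borel (T : topologicalType) : set (set T) := <<s @open T >>.

(* As everywhere in the library, an element of this type is a function on all
   subsets of T, with unspecified values on non-Borel ones. Every set of
   measures defined below only depends on the values on Borel sets. *)
Record borel_prob (R : realType) (T : topologicalType) := BorelProb {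
  bp_inhabited : inhabited T;
  bp_measure :> probability (borel_type bp_inhabited) R
}.

HB.instance Definition _ (R : realType) (T : topologicalType) :=
  gen_eqMixin (borel_prob R T).
HB.instance Definition _ (R : realType) (T : topologicalType) :=
  gen_choiceMixin (borel_prob R T).

(* Intended for compact T, where every continuous function is bounded, hence
   integrable. *)
Definition integral_map (R : realType) (T : topologicalType)
    (mu : borel_prob R T) : prod_topology (fun _ : continuousType T R => R) :=
  fun f => \int[mu]_x f x.

(* The weak-* topology: the coarsest one for which mu |-> \int f dmu is
   continuous for every continuous f : T -> R. *)
HB.instance Definition _ (R : realType) (T : topologicalType) :=
  Topological.copy (borel_prob R T)
    (initial_topology (@integral_map R T)).

Section Measures.
Variables (R : realType) (S : Type) (T : topologicalType) (act : S -> T -> T).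
Local Open Scope ereal_scope.

Definition invariant_measures : set (borel_prob R T) :=
  [set mu | forall s A, Borel A -> mu (act s @^-1` A) = mu A].

Definition ergodic_measures : set (borel_prob R T) :=
  [set mu | invariant_measures mu /\
    forall A : set T, Borel A ->
      (forall s, mu ((act s @^-1` A) `+` A) = 0) -> mu A = 0 \/ mu A = 1].

Definition measure_support (mu : borel_prob R T) : set T :=
  [set x | forall U : set T, open U -> U x -> 0 < mu U].

Definition periodic_measures : set (borel_prob R T) :=
  [set mu | invariant_measures mu /\ finite_set (measure_support mu)].

Definition ergodic_periodic_measures : set (borel_prob R T) :=
  periodic_measures `&` ergodic_measures.

End Measures.
Arguments invariant_measures R {S T} act.
Arguments ergodic_measures R {S T} act.
Arguments periodic_measures R {S T} act.
Arguments ergodic_periodic_measures R {S T} act.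

Section NaturalExtension.
Variables (S : monoidType) (G : groupType) (eta : {multiplicative S -> G}).
Variables (X : topologicalType) (act : S -> X -> X).
Local Open Scope group_scope.

Definition extension_set : set (prod_topology (fun _ : G => X)) :=
  [set x | forall s h, act s (x h) = x (eta s * h)].

(* The subtype carries the subspace topology. *)
Definition extension := set_type extension_set.
HB.instance Definition _ := Topological.on extension.

Lemma extension_shift_subproof (g : G) (x : extension) :
  (fun h => val x (h * g)) \in extension_set.
Proof.
apply/mem_set => s h /=; rewrite -mulgA.
exact: (set_mem (valP x)).
Qed.

Definition extension_shift (g : G) (x : extension) : extension :=
  exist (fun y => y \in extension_set) _ (extension_shift_subproof g x).

Definition extension_proj (x : extension) : X := val x 1.

(* The image of the push-forward by extension_proj of invariant measures. *)
Definition Ext (R : realType) : set (borel_prob R X) :=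
  [set mu | exists2 nu : borel_prob R extension,
    invariant_measures R extension_shift nu &
    forall A : set X, Borel A -> mu A = nu (extension_proj @^-1` A)].

End NaturalExtension.
Arguments extension_shift {S G} eta {X} act.
Arguments extension_proj {S G} eta {X} act.
Arguments Ext {S G} eta {X} act R.

Definition full_shift (S : semigroupType) (A : finType) : topologicalType :=
  prod_topology (fun _ : S => discrete_topology A).

Definition shift_action (S : semigroupType) (A : finType) (s : S)
    (x : full_shift S A) : full_shift S A :=
  fun t => x (t * s)%g.
Arguments shift_action S A : clear implicits.

(* Relative density of P in M, for P contained in M. *)
Definition dense_in (T : topologicalType) (M P : set T) : Prop :=
  P `<=` M /\ M `<=` closure P.

Definition PA (R : realType) (S : semigroupType) : Prop :=
  forall A : finType,
    dense_in (invariant_measures R (shift_action S A))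
             (periodic_measures R (shift_action S A)).

Definition EPA (R : realType) (S : semigroupType) : Prop :=
  forall A : finType,
    dense_in (invariant_measures R (shift_action S A))
             (ergodic_periodic_measures R (shift_action S A)).

(* Main.v *)
Require Import Defs.
From HB Require Import structures.
From mathcomp Require Import all_boot all_order all_algebra fingroup perm.
From mathcomp Require Import all_classical all_reals all_analysis.
From mathcomp Require Import measurable_realfun lra.

(** Write X_Gamma for the natural extension and pi for its projection to X.

    Ext is contained in the closure by pushing forward. The map pi is
    continuous and turns the action of gamma s into that of s, so the image
    under pi of a periodic measure is periodic ([periodic_push]), the image of
    an ergodic one is ergodic ([ergodic_push]), and taking images is weak-*
    continuous ([closure_push]). If an invariant measure on X_Gamma is a limit
    of periodic ones, its image is therefore a limit of periodic measures of X.
    The statements on full shifts are the same argument for the restriction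
    along gamma of A^Gamma to A^S, since an invariant measure on the natural
    extension of A^S can be read as an invariant measure on A^Gamma
    ([Ext_shift_factor]).

    For the reverse inclusion, first let mu be a periodic measure. Invariance
    forces every s to map the finite support F onto itself, so S acts on F by
    permutations. Here freeness enters: this morphism from S to a finite group
    extends to Gamma ([free_Sgroup_lift]), hence every point x of F has a
    Gamma-orbit (h x)_h, which is a point of X_Gamma above x. Moving the atoms
    of mu to these points gives an invariant measure above mu
    ([periodic_lift]).

    A limit mu of periodic measures then has to be lifted by compactness. This
    is done on the level of integrals, regarded as positive functionals on the
    continuous functions of X_Gamma: along an ultrafilter of periodic measures
    converging to mu, the integrals against the lifted measures converge to an
    invariant positive functional L above mu ([limit_lift]). A measure is
    recovered from L as the Daniell upper integral of indicator functions
    ([daniell]), for which open sets are Caratheodory measurable because, Gamma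
    being countable, each is a countable union of sets where a continuous
    function is positive ([daniell_cozero], [extension_cozero_cover]). This
    measure inherits invariance from L by its very definition, and it is
    bounded on a set A by L f as soon as f >= 1 on A. The latter gives
    pi_* nu <= mu on closed sets, and between two probabilities on a metric
    space such an inequality is an equality
    ([borel_prob_eq_of_le_closed]). *)

Set Implicit Arguments.
Unset Strict Implicit.
Unset Printing Implicit Defensive.
Import Order.TTheory GRing.Theory Num.Theory.
Import numFieldNormedType.Exports.
Local Open Scope classical_set_scope.
Local Open Scope ring_scope.

(** * Topological preliminaries *)

Lemma cvg_initial (S : choiceType) (T : topologicalType) (f : S -> T)
    (F : set_system S) (s : S) : Filter F ->
  F --> (s : initial_topology f) <-> f @ F --> f s.
Proof.
move=> FF; split=> [Fs A /initial_continuous/Fs //|Fs A].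
rewrite nbhsE /= => -[_ [[B oB <-] /= Bfs] BA].
by apply: filterS BA _; apply: Fs; exact: open_nbhs_nbhs.
Qed.

Lemma cvg_pointwise (I : Type) (T : I -> topologicalType)
    (F : set_system (prod_topology T)) (f : prod_topology T) : Filter F ->
  F --> f <-> forall i, g i @[g --> F] --> f i.
Proof.
move=> FF; rewrite cvg_sup.
by split=> Ff i; have /cvg_initial := Ff i; apply.
Qed.

Lemma prod_eval_continuous (I : Type) (T : I -> topologicalType) (i : I) :
  continuous (fun f : prod_topology T => f i).
Proof.
move=> f; have FF : Filter (nbhs f) := nbhs_filter f.
exact: (cvg_pointwise f FF).1 (fun A => id) i.
Qed.

Lemma continuous_to_prod (T : topologicalType) (I : Type)
    (U : I -> topologicalType) (f : T -> prod_topology U) :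
  (forall i, continuous (fun x => f x i)) -> continuous f.
Proof.
move=> fc x; have FF : Filter (f @ nbhs x) by exact: fmap_filter.
by apply/(cvg_pointwise _ FF) => i; exact: fc.
Qed.

Lemma closed_equalizer (T U : topologicalType) (f g : T -> U) :
  hausdorff_space U -> continuous f -> continuous g ->
  closed [set x | f x = g x].
Proof.
rewrite open_hausdorff => hU fc gc x clx; apply/eqP; apply: contrapT => /negP.
move=> /hU[[A B] /= [Afx Bgx] [oA oB AB]].
rewrite !inE in Afx Bgx.
have nA : nbhs x (f @^-1` A) by apply: fc; exact: open_nbhs_nbhs.
have nB : nbhs x (g @^-1` B) by apply: gc; exact: open_nbhs_nbhs.
have [y /= [fg [Ay By]]] := clx _ (filterI nA nB).
have : (A `&` B) (f y) by split=> //; rewrite fg.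
by rewrite (eqP AB).
Qed.

(** Otherwise the complements of the members of I would form a proper filter,
    and a cluster point of that filter has no neighbourhood in I. This packages
    the passage from an open cover to a finite one, for a space that may be
    empty. *)
Lemma compact_local_ideal (T : topologicalType) (I : set (set T)) :
  compact [set: T] -> I set0 -> (forall A B, I A -> I B -> I (A `|` B)) ->
  (forall A B, A `<=` B -> I B -> I A) ->
  (forall x : T, exists2 U, nbhs x U & I U) -> I [set: T].
Proof.
move=> cT I0 IU Isub Iloc; apply: contrapT => nIT.
pose F : set_system T := [set A | I (~` A)].
have FF : ProperFilter F.
  split; first by rewrite /F /= setC0.
  split; first by rewrite /F /= setCT.
  - by move=> A B; rewrite /F /= setCI; exact: IU.
  - by move=> A B AB; rewrite /F /=; apply: Isub; exact: subsetC.
have [|x [_ xF]] := cT F FF; first exact: filterT.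
have [U xU IUU] := Iloc x.
have [|y [nUy Uy]] := xF (~` U) U _ xU; first by rewrite /F /= setCK.
exact: nUy.
Qed.

Lemma fmap_ultra (T U : Type) (f : T -> U) (F : set_system T) :
  UltraFilter F -> UltraFilter (f @ F).
Proof.
move=> FU; split; first exact: fmap_proper_filter.
move=> G GF fFG; apply/seteqP; split => // A GA.
have [//|FnA] := in_ultra_setVsetC (f @^-1` A) FU.
have GnA : G (~` A) by apply: fFG.
by have [x []] := filter_ex (filterI GA GnA).
Qed.

Lemma lim_near_eq (R : realType) (T : Type) (F : set_system T) (u v : T -> R)
    (l : R) : ProperFilter F -> F [set p | u p = v p] -> v @ F --> l ->
  lim (u @ F) = l.
Proof.
move=> FF Fuv vl; apply: cvg_lim => //; apply: cvg_trans vl.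
by apply: near_eq_cvg; apply: filterS Fuv => p /= ->.
Qed.

(** * Borel sets and Borel probabilities *)

Lemma Borel_open (T : topologicalType) (U : set T) : open U -> Borel U.
Proof. exact: sub_sigma_algebra. Qed.

Lemma Borel_preimage (T U : topologicalType) (f : T -> U) (A : set U) :
  continuous f -> Borel A -> Borel (f @^-1` A).
Proof.
move=> fc; have : <<s @open U >> `<=` [set B | Borel (f @^-1` B)].
  apply: smallest_sub => [|B oB /=]; last first.
    by apply: Borel_open; by move/continuousP: fc; apply.
  have [b0 bC bU] := smallest_sigma_algebra [set: T] (@open T).
  split=> [|B /= BB|F /= BF]; first by rewrite /= preimage_set0.
  - by rewrite setTD preimage_setC -setTD; exact: bC.
  - by rewrite preimage_bigcup; exact: bU.
by move=> h /h.
Qed.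

Section BorelSets.
Variable T : topologicalType.

Lemma BorelC (A : set T) : Borel A -> Borel (~` A).
Proof.
have [_ bC _] := smallest_sigma_algebra [set: T] (@open T).
by rewrite -setTD; exact: bC.
Qed.

Lemma Borel_bigcup (F : (set T)^nat) :
  (forall n, Borel (F n)) -> Borel (\bigcup_n F n).
Proof. by have [_ _] := smallest_sigma_algebra [set: T] (@open T); apply. Qed.

Lemma BorelU (A B : set T) : Borel A -> Borel B -> Borel (A `|` B).
Proof.
move=> bA bB; rewrite -bigcup2E; apply: Borel_bigcup => -[|[|n]] //=.
exact: Borel_open open0.
Qed.

Lemma BorelD (A B : set T) : Borel A -> Borel B -> Borel (A `\` B).
Proof.
move=> bA bB; rewrite setDE -[_ `&` _]setCK setCI setCK.
by apply: BorelC; apply: BorelU => //; exact: BorelC.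
Qed.

Lemma Borel_closed (C : set T) : closed C -> Borel C.
Proof.
by move=> cC; rewrite -[C]setCK; apply: BorelC; apply: Borel_open;
  exact: closed_openC.
Qed.

End BorelSets.

Section BorelProbabilities.
Variables (R : realType) (T : topologicalType).
Local Open Scope ereal_scope.

Section Construction.
Variables (h : inhabited T) (m : set T -> \bar R).
Hypotheses (m0 : m set0 = 0) (m_ge0 : forall A, 0 <= m A)
  (m_sigma : semi_sigma_additive (m : set (borel_type h) ->
    \bar R)) (m1 : m setT = 1).

Definition set_fun_of_prob : set (borel_type h) -> \bar R := m.
HB.instance Definition _ :=
  isMeasure.Build _ (borel_type h) R set_fun_of_prob m0 m_ge0 m_sigma.
HB.instance Definition _ :=
  Measure_isProbability.Build _ (borel_type h) R set_fun_of_prob m1.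
Definition borel_prob_of : borel_prob R T :=
  @BorelProb R T h (set_fun_of_prob : probability _ _).
End Construction.

Variable mu : borel_prob R T.

Lemma bp0 : mu set0 = 0. Proof. exact: measure0. Qed.

Lemma bpT : mu setT = 1. Proof. exact: probability_setT. Qed.

Lemma bp_le A B : Borel A -> Borel B -> A `<=` B -> mu A <= mu B.
Proof. by move=> bA bB AB; apply: le_measure; rewrite ?inE. Qed.

Lemma bp_null_sub A B : Borel A -> Borel B -> A `<=` B -> mu B = 0 -> mu A = 0.
Proof.
move=> bA bB AB mB; apply/eqP; rewrite eq_le measure_ge0 andbT -mB.
exact: bp_le.
Qed.

Lemma bp_nullU A B : Borel A -> Borel B -> mu A = 0 -> mu B = 0 ->
  mu (A `|` B) = 0.
Proof. by move=> bA bB mA mB; rewrite null_set_setU. Qed.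

Lemma bp_null_bigcup (F : (set T)^nat) : (forall n, Borel (F n)) ->
  (forall n, mu (F n) = 0) -> mu (\bigcup_n F n) = 0.
Proof.
move=> bF mF; apply/(@negligibleP _ (borel_type (bp_inhabited mu)) _ mu).
  exact: Borel_bigcup.
apply: negligible_bigcup => n.
by apply/(@negligibleP _ (borel_type (bp_inhabited mu)) _ mu);
  [exact: bF|exact: mF].
Qed.

Lemma bp_setU_null A N : Borel A -> Borel N -> mu N = 0 -> mu (A `|` N) = mu A.
Proof. by move=> bA bN mN; exact: measureU0. Qed.

End BorelProbabilities.

(** Open sets form a pi-system. Whatever proofs of inhabitation the two measures
    carry, these are equal, so both live on the same pointed type. *)
Lemma borel_prob_unique (R : realType) (T : topologicalType)
    (mu nu : borel_prob R T) : (forall U, open U -> mu U = nu U) ->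
  forall A, Borel A -> mu A = nu A.
Proof.
case: mu nu => [h mu] [k nu] /=; have hk := Prop_irrelevance h k; subst k.
move=> munu A bA.
apply: (@g_sigma_algebra_measure_unique _ R (borel_type h) (@open T) _
  (fun=> setT)) => //.
- by move=> U; exact: Borel_open.
- by move=> _; exact: openT.
- by rewrite bigcup_const//; exists 0%N.
- by move=> U V; exact: openI.
- move=> _; apply: (@le_lt_trans _ _ 1%E); last by rewrite ltry.
  by apply: (@probability_le1 _ _ _ mu); exact: measurableT.
Qed.

Section Integrals.
Variables (R : realType) (T : topologicalType).
Local Open Scope ereal_scope.

Lemma Borel_measurable_fun (h : inhabited T) (f : T -> R) :
  continuous f -> measurable_fun setT (f : borel_type h -> R).
Proof.
move=> /continuousP fc.
apply: (measurability _ (RGenOpens.measurableE R)) => _ [_ [a [b ->] <-]].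
by rewrite setTI; apply: Borel_open; apply: fc; exact: interval_open.
Qed.

Lemma integral_map_eq (mu nu : borel_prob R T) :
  (forall A, Borel A -> mu A = nu A) -> integral_map mu = integral_map nu.
Proof.
case: mu nu => [h mu] [k nu] /=; have hk := Prop_irrelevance h k; subst k.
move=> munu; apply: functional_extensionality_dep => f.
by congr fine; apply: eq_measure_integral => A mA _; exact: munu.
Qed.

End Integrals.

(** The weak-* topology is initial for a map into a product. *)
Lemma cvg_borel_prob (R : realType) (T : topologicalType)
    (F : set_system (borel_prob R T)) (mu : borel_prob R T) : Filter F ->
  F --> mu <-> forall g : continuousType T R,
    (fun p : borel_prob R T => \int[p]_x g x) @ F --> \int[mu]_x g x.
Proof.
move=> FF; have FI : Filter (@integral_map R T @ F) by exact: fmap_filter.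
have H1 := @cvg_initial (borel_prob R T) _ (@integral_map R T) F mu FF.
exact: (iff_trans H1 (@cvg_pointwise _ _ _ _ FI)).
Qed.

Lemma integral_lty (R : realType) (X : topologicalType) (mu : borel_prob R X)
    (g : X -> R) : compact [set: X] -> continuous g -> (forall x, 0 <= g x) ->
  (\int[mu]_x (g x)%:E < +oo)%E.
Proof.
move=> cX gc g0.
have cg : compact (range g).
  by apply: continuous_compact => //; exact: continuous_subspaceT.
have [M [_ Mg]] := compact_bounded cg.
have gM x : g x <= M + 1.
  by apply: le_trans (ler_norm _) _; apply: (Mg (M + 1)); rewrite ?ltrDl//;
    exists x.
apply: (@le_lt_trans _ _ (\int[mu]_x (M + 1)%:E)%E).
  apply: ge0_le_integral => //.
  - by move=> x _; rewrite lee_fin.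
  - by apply/measurable_EFinP; exact: Borel_measurable_fun.
  - by move=> x _; rewrite lee_fin.
rewrite integral_cst// [X in (_ * X)%E](_ : _ = 1%E); last exact: bpT.
by rewrite mule1 ltry.
Qed.

(** * Images of measures under continuous maps *)

Section Push.
Variables (R : realType) (T U : topologicalType) (f : T -> U).
Hypothesis fc : continuous f.
Variable (mu : borel_prob R T).
Local Open Scope ereal_scope.

Lemma push_inhabited : inhabited U.
Proof. by case: (bp_inhabited mu) => x; exists; exact: f x. Qed.

Lemma push_sigma :
  semi_sigma_additive ((fun A => mu (f @^-1` A)) : set (borel_type
    push_inhabited) -> \bar R).
Proof.
move=> F mF tF mUF; rewrite preimage_bigcup.
apply: (@measure_semi_sigma_additive _ (borel_type (bp_inhabited mu))).
- by move=> n; exact: Borel_preimage fc (mF n).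
- apply/trivIsetP => /= i j _ _ ij; rewrite -preimage_setI.
  by move/trivIsetP : tF => /(_ _ _ _ _ ij) ->//; rewrite preimage_set0.
- by rewrite -preimage_bigcup; exact: Borel_preimage fc mUF.
Qed.

Definition bp_push : borel_prob R U :=
  @borel_prob_of R U push_inhabited (fun A => mu (f @^-1` A))
    (bp0 mu) (fun _ => measure_ge0 _ _) push_sigma (bpT mu).

Lemma bp_pushE A : bp_push A = mu (f @^-1` A). Proof. by []. Qed.

End Push.

Section PushIntegrals.
Variables (R : realType) (T U : topologicalType) (f : T -> U).
Hypothesis fc : continuous f.

(** The change of variables for nonnegative functions is applied to the positive
    and to the negative part of g. *)
Lemma integral_push (mu : borel_prob R T) (g : U -> R) : continuous g ->
  \int[bp_push fc mu]_x g x = \int[mu]_x g (f x).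
Proof.
move=> gc; congr fine.
pose F : borel_type (bp_inhabited mu) -> borel_type (push_inhabited f mu) := f.
have mF : measurable_fun setT F.
  by move=> _ A mA; rewrite setTI; exact: Borel_preimage fc mA.
have mg : measurable_fun setT (EFin \o g : borel_type (push_inhabited f mu)
  -> _).
  by apply/measurable_EFinP; apply: Borel_measurable_fun.
have E h : measurable_fun setT h -> (forall y, 0 <= h y)%E ->
    (\int[bp_push fc mu]_y h y = \int[mu]_x h (f x))%E.
  move=> mh h0; transitivity (\int[pushforward mu F]_y h y)%E.
    by apply: eq_measure_integral.
  by rewrite ge0_integral_pushforward// => y _.
rewrite integralE [RHS]integralE; congr (_ - _)%E.
- refine (etrans (E _ (measurable_funepos mg) _) _); last first.
  by apply: eq_integral => x _; rewrite !funeposE.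
  by move=> y; exact: funepos_ge0.
- refine (etrans (E _ (measurable_funeneg mg) _) _); last first.
  by apply: eq_integral => x _; rewrite !funenegE.
  by move=> y; exact: funeneg_ge0.
Qed.

(** The measure nu is only compared with the image of mu on Borel sets, where
    their values are meaningful; the weak-* topology does not distinguish two
    measures that agree there. *)
Lemma closure_push (P : set (borel_prob R T)) (Q : set (borel_prob R U))
    (mu : borel_prob R T) (nu : borel_prob R U) :
  (forall p, P p -> Q (bp_push fc p)) -> closure P mu ->
  (forall A, Borel A -> nu A = mu (f @^-1` A)) -> closure Q nu.
Proof.
move=> PQ Pmu numu.
have nuE : integral_map nu = integral_map (bp_push fc mu).
  by apply: integral_map_eq => A bA; rewrite numu.
have muF : Filter (nbhs mu) by exact: nbhs_filter.
have muFU : Filter (@bp_push R T U f fc @ mu) by exact: fmap_filter.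
have push_cvg : @bp_push R T U f fc @ mu --> nu.
  apply/(cvg_borel_prob _ muFU) => g.
  have -> : \int[nu]_x g x = \int[mu]_x (g \o mkcts fc) x.
    have /(congr1 (fun h => h g)) := nuE; rewrite /integral_map => ->.
    by rewrite integral_push//; exact: cts_fun.
  have := (cvg_borel_prob mu muF).1 (fun A => id) (g \o mkcts fc).
  have <- : (fun p : borel_prob R U => \int[p]_x g x) \o @bp_push R T U f fc
      = (fun p : borel_prob R T => \int[p]_x (g \o mkcts fc) x).
    by apply/funext => p /=; rewrite integral_push//; exact: cts_fun.
  exact.
move=> B /push_cvg /Pmu[p [Pp Bp]].
by exists (bp_push fc p); split => //; exact: PQ.
Qed.

End PushIntegrals.

(** * Supports, invariance and ergodicity under factor maps *)

(** Each point of C has a null neighbourhood, and by compactness finitely many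
    of them cover C. *)
Lemma closed_off_support (R : realType) (T : topologicalType)
    (mu : borel_prob R T) (C : set T) : compact [set: T] -> closed C ->
  C `&` measure_support mu = set0 -> mu C = 0%E.
Proof.
move=> cT cC Csupp.
pose I (A : set T) := exists B, [/\ Borel B, A `&` C `<=` B & mu B = 0%E].
suff [B [bB CB mB]] : I setT.
  by apply: (bp_null_sub _ bB _ mB); [exact: Borel_closed|rewrite setTI in CB].
apply: compact_local_ideal => //.
- exists set0; split; [exact: Borel_open open0|by rewrite set0I|exact: bp0].
- move=> A B [A' [bA AA mA]] [B' [bB BB mB]]; exists (A' `|` B').
  split; [exact: BorelU|by rewrite setIUl; exact: setUSS|exact: bp_nullU].
- by move=> A B AB [B' [bB BB mB]]; exists B'; split=> // x [/AB Bx Cx];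
    exact: BB.
- move=> x; have [Cx|nCx] := pselect (C x); last first.
    exists (~` C); first by apply: open_nbhs_nbhs; split => //;
      exact: closed_openC.
    by exists set0; split; [exact: Borel_open open0|rewrite setICl|exact: bp0].
  have /existsNP[U /not_implyP[oU /not_implyP[Ux /negP]]] :
    ~ measure_support mu x.
    by move=> sx; suff : set0 x by []; rewrite -Csupp.
  rewrite -leNgt => mU; exists U; first exact: open_nbhs_nbhs.
  exists U; split; [exact: Borel_open|by move=> ? []|].
  by apply/eqP; rewrite eq_le mU measure_ge0.
Qed.

Section PushDynamics.
Variables (R : realType) (T U : topologicalType) (f : T -> U).
Hypothesis fc : continuous f.
Local Open Scope ereal_scope.

(** The support of the image lies in the image of the support: a point y
    outside of the finite, hence closed, image has a closed neighbourhood whose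
    preimage misses the support, and that preimage is null. *)
Lemma finite_support_push (mu : borel_prob R T) : compact [set: T] ->
    compact [set: U] -> hausdorff_space U -> finite_set (measure_support mu) ->
  finite_set (measure_support (bp_push fc mu)).
Proof.
move=> cT cU hU fmu.
apply: (@sub_finite_set _ _ (f @` measure_support mu));
  last exact: finite_image.
move=> y sy; apply: contrapT => nfy.
have oD : open (~` (f @` measure_support mu)).
  apply: closed_openC; apply: (accessible_finite_set_closed.1 _).
    exact: hausdorff_accessible.
  exact: finite_image.
have [V yV VD] : filter_from (nbhs y) closure (~` (f @` measure_support mu)).
  have := @compact_regular _ y setT hU cU filterT; apply.
  exact: open_nbhs_nbhs.
move: yV; rewrite nbhsE /= => -[W [oW Wy] WV].
have := sy W oW Wy; rewrite bp_pushE.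
rewrite (@bp_null_sub _ _ _ _ (f @^-1` closure V)) ?ltxx//.
- by apply: Borel_preimage => //; exact: Borel_open.
- by apply: Borel_preimage => //; apply: Borel_closed; exact: closed_closure.
- by apply: preimage_subset; apply: subset_trans WV _; exact: subset_closure.
- apply: closed_off_support => //.
    by apply: preimage_closed => //; exact: closed_closure.
  by rewrite -subset0 => x [/VD nx sx]; apply: nx; exists x.
Qed.

(** The index sets of the two actions may differ, for the actions of Gamma and
    of S as well as for two actions of Gamma. *)
Lemma invariant_push (I J : Type) (a : I -> T -> T) (b : J -> U -> U)
    (mu : borel_prob R T) :
  (forall j, continuous (b j)) ->
  (forall j, exists i, forall x, f (a i x) = b j (f x)) ->
  invariant_measures R a mu -> invariant_measures R b (bp_push fc mu).
Proof.
move=> bc ab imu j A bA; have [i fi] := ab j.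
change (mu (f @^-1` (b j @^-1` A)) = mu (f @^-1` A)).
rewrite -(imu i (f @^-1` A)); last exact: Borel_preimage.
by congr (mu _); apply/funext => x /=; rewrite fi.
Qed.

Lemma periodic_push (I J : Type) (a : I -> T -> T) (b : J -> U -> U)
    (mu : borel_prob R T) :
  compact [set: T] -> compact [set: U] -> hausdorff_space U ->
  (forall j, continuous (b j)) ->
  (forall j, exists i, forall x, f (a i x) = b j (f x)) ->
  periodic_measures R a mu -> periodic_measures R b (bp_push fc mu).
Proof.
move=> cT cU hU bc ab [imu fmu]; split; first exact: invariant_push.
exact: finite_support_push.
Qed.

End PushDynamics.

Lemma Sgroup_ind (S : semigroupType) (G : groupType)
    (eta : {multiplicative S -> G}) (P : G -> Prop) : is_Sgroup eta ->
  (P 1)%g -> (forall x y, P x -> P y -> P (x * y)%g) ->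
  (forall x, P x -> P x^-1)%g -> (forall s, P (eta s)) -> forall g, P g.
Proof.
move=> eta_gen P1 PM PV Pe g; have : [set: G] g by [].
rewrite -eta_gen => /(_ P); apply; split => //.
by move=> _ [s _ <-].
Qed.

Section Ergodic.
Variables (R : realType) (S : semigroupType) (G : groupType).
Variables (gamma : {multiplicative S -> G}) (gamma_gen : is_Sgroup gamma).
Variables (T : topologicalType) (a : G -> T -> T).
Hypotheses (ac : forall g, continuous (a g)) (a_act : is_action a).
Variable mu : borel_prob R T.
Hypothesis mu_inv : invariant_measures R a mu.
Local Open Scope ereal_scope.

Lemma BorelY (A B : set T) : Borel A -> Borel B -> Borel (A `+` B).
Proof.
move=> bA bB; rewrite /setY.
by apply: BorelU; exact: BorelD.
Qed.

(** Ergodicity under S only tests the elements gamma s, ergodicity under Gamma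
    all elements. They agree because the elements that move B by a null set
    form a subgroup: for products use the triangle inequality for symmetric
    differences, for inverses the invariance of mu. *)
Lemma almost_invariant_subgroup (B : set T) : Borel B ->
  (forall s, mu ((a (gamma s) @^-1` B) `+` B) = 0) ->
  forall g, mu ((a g @^-1` B) `+` B) = 0.
Proof.
move=> bB Bs; have bpre g : Borel (a g @^-1` B) by exact: Borel_preimage.
have [aM a1] := a_act.
apply: (Sgroup_ind gamma_gen) => // [|x y mx my|x mx].
- rewrite (_ : _ @^-1` _ = B); last by apply/funext => x /=; rewrite a1.
  by rewrite setYK bp0.
- apply: (@bp_null_sub _ _ _ _
    ((a y @^-1` ((a x @^-1` B) `+` B)) `|` ((a y @^-1` B) `+` B))).
  + exact: BorelY.
  + apply: BorelU; last exact: BorelY.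
    by apply: Borel_preimage => //; exact: BorelY.
  + move=> z /=; rewrite /setY /setD /= aM.
    by have [] := pselect (B (a y z)); tauto.
  + apply: bp_nullU.
    * by apply: Borel_preimage => //; exact: BorelY.
    * exact: BorelY.
    * by rewrite mu_inv//; exact: BorelY.
    * exact: my.
- rewrite -(mu_inv x); last exact: BorelY.
  rewrite -[RHS]mx; congr (mu _); apply/funext => z /=.
  rewrite /setY /setD /= -aM mulVg a1; apply/propext; tauto.
Qed.

Lemma ergodic_push (U : topologicalType) (b : S -> U -> U) (f : T -> U)
    (fc : continuous f) : (forall s, continuous (b s)) ->
  (forall s x, f (a (gamma s) x) = b s (f x)) ->
  ergodic_measures R a mu -> ergodic_measures R b (bp_push fc mu).
Proof.
move=> bc fab [_ erg]; split.
  by apply: invariant_push mu_inv => // s; exists (gamma s).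
move=> A bA As; apply: erg; first exact: Borel_preimage.
apply: almost_invariant_subgroup => [|s]; first exact: Borel_preimage.
rewrite -[RHS](As s); congr (mu _); apply/funext => x /=.
by rewrite /setY /setD /= fab.
Qed.

End Ergodic.

(** * The natural extension and the full shifts *)

Section Extension.
Variables (S : monoidType) (G : groupType) (eta : {multiplicative S -> G}).
Variables (X : topologicalType) (act : S -> X -> X).

Lemma val_extension_continuous :
  continuous (fun x : extension eta act => val x : prod_topology (fun _ : G
    => X)).
Proof. exact: initial_continuous. Qed.

Lemma extension_coord_continuous h : continuous (fun x : extension eta act =>
  val x h).
Proof.
move=> x; exact: (continuous_comp (@val_extension_continuous x)
  (@prod_eval_continuous G (fun=> X) h _)).
Qed.

Lemma extension_shift_continuous g : continuous (extension_shift eta act g).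
Proof.
move=> x.
have FF : Filter (extension_shift eta act g @ nbhs x) by exact: fmap_filter.
apply/(@cvg_initial _ _ (@set_val _ (extension_set eta act)) _ _ FF).
have /(_ _ x) := @continuous_to_prod (extension eta act) G (fun=> X)
  (fun y => val (extension_shift eta act g y)); apply => h.
exact: extension_coord_continuous.
Qed.

Lemma extension_shift_action : is_action (extension_shift eta act).
Proof.
split=> [g h x|x]; apply: val_inj; apply: funext => k /=.
  by rewrite mulgA.
by rewrite mulg1.
Qed.

Lemma extension_proj_continuous : continuous (extension_proj eta act).
Proof. by move=> x; exact: extension_coord_continuous. Qed.

Hypothesis actc : is_continuous_action act.

(** This is the relation defining the extension, at the coordinate 1. *)
Lemma extension_projM s (x : extension eta act) :
  extension_proj eta act (extension_shift eta act (eta s) x) =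
  act s (extension_proj eta act x).
Proof.
have := set_mem (valP x); move=> /(_ s 1%g) /=.
by rewrite mulg1 => e; rewrite /extension_proj e /= mul1g.
Qed.

Hypotheses (cX : compact [set: X]) (hX : hausdorff_space X).

Lemma closed_extension_set : closed (extension_set eta act).
Proof.
rewrite (_ : extension_set eta act = \bigcap_s \bigcap_h
    [set x : prod_topology (fun _ : G => X) | act s (x h) = x (eta s * h)%g]).
  apply: closed_bigI => s _; apply: closed_bigI => h _.
  apply: closed_equalizer => //;
    last exact: (@prod_eval_continuous G (fun=> X)).
  move=> x; apply: continuous_comp;
    first exact: (@prod_eval_continuous G (fun=> X)).
  exact: actc.2.
by apply/seteqP; split=> [x ex s _ h _|x ex s h]; [exact: ex|exact: ex].
Qed.

(** A cluster point in the compact product of copies of X stays in the closed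
    set of compatible families. *)
Lemma compact_extension : compact [set: extension eta act].
Proof.
move=> F FF _.
pose toP (x : extension eta act) : prod_topology (fun _ : G => X) := val x.
pose Fv := toP @ F.
have FvF : ProperFilter Fv by exact: fmap_proper_filter.
have cP : compact [set: prod_topology (fun _ : G => X)].
  have := @tychonoff G (fun=> X) (fun=> setT) (fun=> cX).
  by congr compact; apply/seteqP; split.
have [|p [_ pF]] := cP Fv FvF; first exact: filterT.
have ep : extension_set eta act p.
  apply: closed_extension_set => B pB; apply: pF => //.
  rewrite /Fv /=; apply: filterS filterT => x _ /=.
  exact: (set_mem (valP x)).
exists (exist _ p (mem_set ep)); split => // A B FA.
rewrite nbhsE /= => -[_ [[W oW <-] Wp] WB].
have pW : nbhs p W by apply: open_nbhs_nbhs.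
have [|_ [[x Ax <-] Wx]] :=
  pF ((fun x : extension eta act => val x) @` A) W _ pW.
  by rewrite /Fv /=; apply: filterS FA => x Ax; exists x.
by exists x; split => //; exact: WB.
Qed.

End Extension.

Section FullShift.
Variables (S : semigroupType) (A : finType).

Lemma compact_full_shift : compact [set: full_shift S A].
Proof.
have cA : compact [set: discrete_topology A].
  by apply: finite_compact; exact: finite_finset.
have := @tychonoff S (fun=> discrete_topology A) (fun=> setT) (fun=> cA).
by congr compact; apply/seteqP; split.
Qed.

Lemma hausdorff_full_shift : hausdorff_space (full_shift S A).
Proof.
apply: (@hausdorff_product S (fun=> discrete_topology A)) => _.
exact: discrete_hausdorff.
Qed.

Lemma shift_action_continuous s : continuous (shift_action S A s).
Proof.
apply: (@continuous_to_prod _ S (fun=> discrete_topology A)) => t.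
exact: (@prod_eval_continuous S (fun=> discrete_topology A)).
Qed.

End FullShift.

(** * Pushing periodic measures forward *)

Section ExtSubClosure.
Variables (R : realType) (S : monoidType) (G : groupType).
Variables (gamma : {multiplicative S -> G}) (gamma_gen : is_Sgroup gamma).
Variables (X : topologicalType) (act : S -> X -> X).
Hypotheses (cX : compact [set: X]) (hX : hausdorff_space X).
Hypothesis actc : is_continuous_action act.

Section Factor.
Variables (Y : topologicalType) (a : G -> Y -> Y) (phi : Y -> X).
Hypotheses (cY : compact [set: Y]) (ac : forall g, continuous (a g)).
Hypotheses (a_act : is_action a) (phic : continuous phi).
Hypothesis phi_equiv : forall s y, phi (a (gamma s) y) = act s (phi y).

Let periodic_factor nu : periodic_measures R a nu ->
  periodic_measures R act (bp_push phic nu).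
Proof.
apply: periodic_push => //; first exact: actc.2.
by move=> s; exists (gamma s).
Qed.

Lemma closure_periodic_factor (nu : borel_prob R Y) (mu : borel_prob R X) :
  (forall A, Borel A -> mu A = nu (phi @^-1` A)) ->
  closure (periodic_measures R a) nu -> closure (periodic_measures R act) mu.
Proof.
by move=> munu clnu; apply: closure_push clnu munu; exact: periodic_factor.
Qed.

Lemma closure_ergodic_factor (nu : borel_prob R Y) (mu : borel_prob R X) :
  (forall A, Borel A -> mu A = nu (phi @^-1` A)) ->
  closure (ergodic_periodic_measures R a) nu ->
  closure (ergodic_periodic_measures R act) mu.
Proof.
move=> munu clnu; apply: closure_push clnu munu => p [pp ep].
split; first exact: periodic_factor.
by apply: (ergodic_push gamma_gen) => //; [exact: pp.1|exact: actc.2].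
Qed.

End Factor.

Lemma Ext_sub_closure_periodic :
  dense_in (invariant_measures R (extension_shift gamma act))
           (periodic_measures R (extension_shift gamma act)) ->
  Ext gamma act R `<=` closure (periodic_measures R act).
Proof.
move=> [_ dense] mu [nu nu_inv munu].
apply: (closure_periodic_factor _ _ _ munu (dense _ nu_inv)).
- exact: compact_extension.
- exact: extension_proj_continuous.
- by move=> s x; exact: extension_projM.
Qed.

Lemma Ext_sub_closure_ergodic :
  dense_in (invariant_measures R (extension_shift gamma act))
           (ergodic_periodic_measures R (extension_shift gamma act)) ->
  Ext gamma act R `<=` closure (ergodic_periodic_measures R act).
Proof.
move=> [_ dense] mu [nu nu_inv munu].
apply: (closure_ergodic_factor _ _ _ _ _ munu (dense _ nu_inv)).
- exact: compact_extension.
- exact: extension_shift_continuous.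
- exact: extension_shift_action.
- exact: extension_proj_continuous.
- by move=> s x; exact: extension_projM.
Qed.

End ExtSubClosure.

Section FullShiftDensity.
Variables (R : realType) (S : monoidType) (G : groupType).
Variables (gamma : {multiplicative S -> G}) (gamma_gen : is_Sgroup gamma).
Variable A : finType.

Lemma shift_continuous_action (M : monoidType) :
  is_continuous_action (shift_action M A).
Proof.
split; last exact: shift_action_continuous.
by split=> [s t x|x]; apply: funext => u; rewrite /shift_action ?mulgA ?mulg1.
Qed.

Lemma shift_group_action : is_action (shift_action G A).
Proof. exact: (shift_continuous_action G).1. Qed.

(** In the natural extension of A^S one has x_h(t) = x_(gamma(t) h)(1), so a
    point is determined by its letters x_h(1): this map is the isomorphism of
    the extension with A^Gamma. *)
Definition origin_coding (x : extension gamma (shift_action S A)) :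
    full_shift G A := fun h => val x h 1%g.

Lemma origin_coding_continuous : continuous origin_coding.
Proof.
apply: (@continuous_to_prod _ G (fun=> discrete_topology A)) => h x.
have c1 := @extension_coord_continuous S G gamma _ (shift_action S A) h x.
have c2 := @prod_eval_continuous S (fun=> discrete_topology A) 1%g (val x h).
exact: (continuous_comp c1 c2).
Qed.

Definition restrict_along (y : full_shift G A) : full_shift S A := y \o gamma.

Lemma restrict_continuous : continuous restrict_along.
Proof.
apply: (@continuous_to_prod _ S (fun=> discrete_topology A)) => s.
exact: (@prod_eval_continuous G (fun=> discrete_topology A)).
Qed.

Lemma restrict_along_origin_coding x :
  restrict_along (origin_coding x) = extension_proj gamma (shift_action S A) x.
Proof.
apply: funext => t; rewrite /restrict_along /origin_coding /extension_proj /=.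
have /(_ t 1%g) := set_mem (valP x); rewrite mulg1 => <-.
by rewrite /shift_action mul1g.
Qed.

Lemma restrict_equiv s y :
  restrict_along (shift_action G A (gamma s) y) =
  shift_action S A s (restrict_along y).
Proof.
by apply: funext => t; rewrite /restrict_along /shift_action /= gmulfM.
Qed.

Lemma Ext_shift_factor (mu : borel_prob R (full_shift S A)) :
  Ext gamma (shift_action S A) R mu ->
  exists2 nu, invariant_measures R (shift_action G A) nu &
    forall B, Borel B -> mu B = nu (restrict_along @^-1` B).
Proof.
move=> [nu nu_inv munu]; exists (bp_push origin_coding_continuous nu).
  apply: invariant_push nu_inv => g; first exact: shift_action_continuous.
  by exists g.
move=> B bB; rewrite munu//; congr (nu _).
by apply: funext => x /=; rewrite restrict_along_origin_coding.
Qed.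

End FullShiftDensity.

Section PAShift.
Variables (R : realType) (S : monoidType) (G : groupType).
Variables (gamma : {multiplicative S -> G}) (gamma_gen : is_Sgroup gamma).
Hypothesis Ext_all : forall A : finType,
  Ext gamma (shift_action S A) R = invariant_measures R (shift_action S A).

Lemma PA_of_Ext : PA R G -> PA R S.
Proof.
move=> PAG A; split=> [mu []//|mu]; rewrite -Ext_all.
move=> /Ext_shift_factor[nu nu_inv munu].
apply: (closure_periodic_factor _ _ _ _ _ _ munu ((PAG A).2 _ nu_inv)).
- exact: compact_full_shift.
- exact: hausdorff_full_shift.
- exact: shift_continuous_action.
- exact: compact_full_shift.
- exact: restrict_continuous.
- exact: restrict_equiv.
Qed.

Lemma EPA_of_Ext : EPA R G -> EPA R S.
Proof.
move=> PAG A; split=> [mu [[]]//|mu]; rewrite -Ext_all.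
move=> /Ext_shift_factor[nu nu_inv munu].
have clnu := (PAG A).2 _ nu_inv.
apply: (closure_ergodic_factor gamma_gen _ _ _ _ _ _ _ _ munu clnu).
- exact: compact_full_shift.
- exact: hausdorff_full_shift.
- exact: shift_continuous_action.
- exact: compact_full_shift.
- exact: shift_action_continuous.
- exact: shift_group_action.
- exact: restrict_continuous.
- exact: restrict_equiv.
Qed.

End PAShift.

(** * A measure built from a positive functional *)

Section Daniell.
Variables (R : realType) (Y : topologicalType) (L : (Y -> R) -> R).
Hypothesis cY : compact [set: Y].
Hypothesis L_cst : forall c, L (fun=> c) = c.
Hypothesis L_add : forall f g : Y -> R, continuous f -> continuous g ->
  L (fun x => f x + g x) = L f + L g.
Hypothesis L_le : forall f g : Y -> R, continuous f -> continuous g ->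
  (forall x, f x <= g x) -> L f <= L g.

(** Increasing sequences of functions play the role of countable covers. They
    are preferred to series of nonnegative functions because countable
    subadditivity then involves no double series. *)
Definition covers (g : nat -> Y -> R) (A : set Y) : Prop :=
  [/\ forall n, continuous (g n), forall n x, 0 <= g n x,
      forall m n x, (m <= n)%N -> g m x <= g n x &
      forall x, A x -> exists n, 1 <= g n x].

Definition cover_bound (A : set Y) : set R :=
  [set a | exists2 g, covers g A & forall n, L (g n) <= a].

(** The upper integral of the indicator of A with respect to L. *)
Definition daniell (A : set Y) : \bar R :=
  ereal_inf [set a%:E | a in cover_bound A].

Lemma daniell_le A a : cover_bound A a -> (daniell A <= a%:E)%E.
Proof. by move=> Aa; apply: ereal_inf_lbound; exists a. Qed.

Lemma daniell_ge A b :
  (forall a, cover_bound A a -> (b <= a%:E)%E) -> (b <= daniell A)%E.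
Proof. by move=> bA; apply: le_ereal_inf_tmp => _ [a Aa <-]; exact: bA. Qed.

Lemma L_ge0 (f : Y -> R) : continuous f -> (forall x, 0 <= f x) -> 0 <= L f.
Proof.
move=> fc f0; rewrite -(L_cst 0); apply: L_le => //.
exact: cst_continuous.
Qed.

Lemma cover_bound_ge0 A a : cover_bound A a -> 0 <= a.
Proof.
by move=> [g [gc g0 _ _] /(_ 0%N)]; apply: le_trans; exact: L_ge0.
Qed.

Lemma cover_bound_fun A (f : Y -> R) : continuous f -> (forall x, 0 <= f x) ->
  (forall x, A x -> 1 <= f x) -> cover_bound A (L f).
Proof.
move=> fc f0 Af; exists (fun=> f) => //; split => // x Ax.
by exists 0%N; exact: Af.
Qed.

Lemma daniell_fun A (f : Y -> R) : continuous f -> (forall x, 0 <= f x) ->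
  (forall x, A x -> 1 <= f x) -> (daniell A <= (L f)%:E)%E.
Proof. by move=> fc f0 Af; apply: daniell_le; exact: cover_bound_fun. Qed.

Lemma daniell_ge0 A : (0 <= daniell A)%E.
Proof. by apply: daniell_ge => a /cover_bound_ge0; rewrite lee_fin. Qed.

Lemma daniell_le1 A : (daniell A <= 1)%E.
Proof.
rewrite -[X in (_ <= X%:E)%E](L_cst 1); apply: daniell_fun => // x.
exact: cst_continuous.
Qed.

Lemma daniell_fin A : daniell A \is a fin_num.
Proof.
by rewrite ge0_fin_numE ?daniell_ge0// (le_lt_trans (daniell_le1 A))// ltry.
Qed.

Lemma daniell_set0 : daniell set0 = 0%E.
Proof.
apply/eqP; rewrite eq_le daniell_ge0 andbT.
rewrite -[X in (_ <= X%:E)%E](L_cst 0); apply: daniell_fun => // x.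
exact: cst_continuous.
Qed.

Lemma le_daniell : {homo daniell : A B / A `<=` B >-> (A <= B)%E}.
Proof.
move=> A B AB; apply: daniell_ge => a [g [gc g0 gm gB] ga].
by apply: daniell_le; exists g => //; split => // x /AB; exact: gB.
Qed.

Lemma sum_continuous (F : nat -> Y -> R) n : (forall i, continuous (F i)) ->
  continuous (fun x => \sum_(i < n) F i x).
Proof.
move=> Fc; elim: n => [|n IH].
  rewrite (_ : (fun x => _) = fun=> 0); first exact: cst_continuous.
  by apply/funext => x; rewrite big_ord0.
rewrite (_ : (fun x => _) = fun x => \sum_(i < n) F i x + F n x).
  by move=> x; apply: cvgD; [exact: IH|exact: Fc].
by apply/funext => x; rewrite big_ord_recr.
Qed.

Lemma L_sum (F : nat -> Y -> R) n : (forall i, continuous (F i)) ->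
  L (fun x => \sum_(i < n) F i x) = \sum_(i < n) L (F i).
Proof.
move=> Fc; elim: n => [|n IH].
  rewrite big_ord0 -[RHS](L_cst 0); congr L.
  by apply/funext => x; rewrite big_ord0.
rewrite big_ord_recr /= -IH -L_add//; last exact: sum_continuous.
by congr L; apply/funext => x; rewrite big_ord_recr.
Qed.

(** If g_i covers the i-th set with bound a_i, the diagonal sequence of partial
    sums g_0 n + ... + g_(n-1) n is increasing, covers the union, and is bounded
    by the sum of the a_i. *)
Lemma daniell_sigma_subadditive : sigma_subadditive daniell.
Proof.
move=> F; apply/lee_addgt0Pr => e e0.
have /choice[a aP] i : exists a, cover_bound (F i) a /\
    (a%:E <= daniell (F i) + (e / (2 ^ i.+1)%:R)%:E)%E.
  have ei0 : 0 < e / (2 ^ i.+1)%:R by rewrite divr_gt0.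
  have [_ [a Fa <-] /ltW ae] := lb_ereal_inf_adherent ei0 (daniell_fin (F i)).
  by exists a.
have a0 i : 0 <= a i by have [/cover_bound_ge0] := aP i.
have := epsilon_trick xpredT (fun i => daniell_ge0 (F i)) (ltW e0).
apply: le_trans; apply: (@le_trans _ _ (\sum_(i <oo) (a i)%:E)%E); last first.
  by apply: lee_nneseries => // [i _|i _]; [rewrite lee_fin|have [] := aP i].
have [->|noo] := eqVneq (\sum_(i <oo) (a i)%:E)%E +oo%E; first by rewrite leey.
have sfin : (\sum_(i <oo) (a i)%:E)%E \is a fin_num.
  rewrite ge0_fin_numE ?ltey//.
  by apply: nneseries_ge0 => i _ _; rewrite lee_fin.
rewrite -(fineK sfin); apply: daniell_le.
have /choice[g gP] i : exists g, covers g (F i) /\ forall n, L (g n) <= a i.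
  by have [[g ? ?] _] := aP i; exists g.
have gc i n : continuous (g i n) by have [[]] := gP i.
have g0 i n x : 0 <= g i n x by have [[]] := gP i.
have gm i m n x : (m <= n)%N -> g i m x <= g i n x.
  by have [[_ _ h _] _] := gP i; exact: h.
exists (fun n x => \sum_(i < n) g i n x); first split.
- by move=> n; apply: (@sum_continuous (fun i => g i n)) => i; exact: gc.
- by move=> n x; apply: sumr_ge0.
- move=> m n x mn; rewrite -!(big_mkord xpredT (fun i => g i _ x)).
  rewrite (big_cat_nat (leq0n m) mn) /= -[X in X <= _]addr0.
  apply: lerD; last exact: sumr_ge0.
  by apply: ler_sum => i _; exact: gm.
- move=> x [i _ Fix]; have [[_ _ _ /(_ _ Fix)[k gk]] _] := gP i.
  exists (maxn k i.+1).
  have iM : (i < maxn k i.+1)%N by rewrite leq_max leqnn orbT.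
  rewrite (bigD1 (Ordinal iM)) //= -[1]addr0; apply: lerD; last exact: sumr_ge0.
  by apply: (le_trans gk); apply: gm; rewrite leq_maxl.
- move=> n; rewrite (@L_sum (fun i => g i n))//.
  apply: (@le_trans _ _ (\sum_(i < n) a i)).
    by apply: ler_sum => i _; have [_] := gP i.
  rewrite -lee_fin (fineK sfin) -sumEFin.
  rewrite -(big_mkord xpredT (fun i => (a i)%:E)).
  by apply: nneseries_lim_ge => i _ _; rewrite lee_fin.
Qed.

HB.instance Definition _ := @isOuterMeasure.Build R Y daniell
  daniell_set0 daniell_ge0 le_daniell daniell_sigma_subadditive.

(** This is Dini's argument: an increasing cover of a compact space exceeds
    1 - e everywhere from some index on. *)
Lemma daniell_setT : daniell setT = 1%E.
Proof.
apply/eqP; rewrite eq_le daniell_le1 /=.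
apply: daniell_ge => a [g [gc g0 gm gT] ga].
rewrite lee_fin; apply/ler_addgt0Pr => e e0.
pose I (A : set Y) := exists n, forall x, A x -> 1 - e <= g n x.
suff [n gn] : I setT.
  rewrite -lerBlDr; apply: le_trans (ga n); rewrite -(L_cst (1 - e)).
  apply: L_le => // [|x]; [exact: cst_continuous|exact: gn].
apply: compact_local_ideal => //.
- by exists 0%N.
- move=> A B [m mA] [n nB]; exists (maxn m n) => x [/mA|/nB] h.
    by apply: (le_trans h); apply: gm; rewrite leq_maxl.
  by apply: (le_trans h); apply: gm; rewrite leq_maxr.
- by move=> A B AB [n nB]; exists n => x /AB; exact: nB.
- move=> x; have [n gn] := gT x Logic.I.
  exists [set y | 1 - e < g n y]; last by exists n => y /= /ltW.
  apply: (gc n x [set z | 1 - e < z]); apply: open_nbhs_nbhs; split.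
    exact: open_gt.
  by rewrite /= (lt_le_trans _ gn)// ltrBlDr ltrDl.
Qed.

Section Cozero.
Variable u : Y -> R.
Hypotheses (uc : continuous u) (u0 : forall x, 0 <= u x).

Let v n x : R := Num.min 1 (n%:R * u x).

Let vc n : continuous (v n).
Proof.
move=> x; apply: (@continuous_min _ _ (fun=> 1) (fun x => n%:R * u x)).
  exact: cvg_cst.
by apply: cvgM; [exact: cvg_cst|exact: uc].
Qed.

Let v0 n x : 0 <= v n x.
Proof. by rewrite le_min ler01 /= mulr_ge0. Qed.

Let v1 n x : v n x <= 1.
Proof. by rewrite ge_min lexx. Qed.

Let vm m n x : (m <= n)%N -> v m x <= v n x.
Proof.
move=> mn; rewrite le_min ge_min lexx /= ge_min; apply/orP; right.
by apply: ler_wpM2r => //; rewrite ler_nat.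
Qed.

(** The functions v_n = min(1, n u) increase to the indicator of U = (u > 0).
    Split a cover g_n of X into g_n v_n, which covers the part inside U, and
    g_n (1 - v_M), which covers the part outside U for each fixed M. If a bounds
    L g_n and c is the measure of the part outside, the second family shows
    L (g_M v_M) <= a - c, for every M; so a - c bounds the first family. *)
Lemma daniell_cozero : daniell.-caratheodory [set x | 0 < u x].
Proof.
apply: le_caratheodory_measurable => X.
apply: daniell_ge => a [g [gc g0 gm gX] ga].
pose U := [set x | 0 < u x].
set c := fine (daniell (X `&` ~` U)).
have cE : daniell (X `&` ~` U) = c%:E by rewrite fineK// daniell_fin.
have gvc n k : continuous (fun x => g n x * v k x).
  by move=> x; apply: cvgM; [exact: gc|exact: vc].
have gwc n k : continuous (fun x => g n x * (1 - v k x)).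
  move=> x; apply: cvgM; first exact: gc.
  by apply: cvgB; [exact: cvg_cst|exact: vc].
have split n k :
    L (fun x => g n x * v k x) + L (fun x => g n x * (1 - v k x)) = L (g n).
  rewrite -L_add//; congr L; apply/funext => x.
  by rewrite -mulrDr addrC subrK mulr1.
have w0 k x : 0 <= 1 - v k x by rewrite subr_ge0.
(* the part of X outside of U is covered, for each fixed M *)
have cM M : L (fun x => g M x * v M x) <= a - c.
  rewrite lerBrDl -lerBrDr -lee_fin -cE; apply: daniell_le.
  exists (fun n x => g n x * (1 - v M x)); first split.
  - by move=> n; exact: gwc.
  - by move=> n x; exact: mulr_ge0.
  - by move=> m n x mn; apply: ler_wpM2r => //; exact: gm.
  - move=> x [/gX[n gn] /negP]; rewrite -leNgt => ux.
    have ux0 : u x = 0 by apply/eqP; rewrite eq_le ux u0.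
    exists n; rewrite /v ux0 mulr0.
    by rewrite /Num.min ltr10 subr0 mulr1.
  - move=> n.
    apply: (@le_trans _ _ (L (fun x => g (maxn n M) x * (1 - v M x)))).
      apply: L_le => // x; apply: ler_wpM2r => //; apply: gm; exact: leq_maxl.
    rewrite lerBrDl; apply: le_trans (ga (maxn n M)).
    rewrite -(split _ M) lerD2r.
    apply: L_le => // x; apply: ler_wpM2r => //; apply: gm; exact: leq_maxr.
change (daniell (X `&` U) + daniell (X `&` ~` U) <= a%:E)%E.
rewrite cE -leeBrDr// -EFinB; apply: daniell_le.
exists (fun n x => g n x * v n x) => //; split.
- by move=> n; exact: gvc.
- by move=> n x; exact: mulr_ge0.
- by move=> m n x mn; apply: ler_pM => //; [exact: gm|exact: vm].
- move=> x [/gX[n gn] /= ux].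
  pose k := (Num.truncn (u x)^-1).+1.
  exists (maxn n k).
  have vk : v (maxn n k) x = 1.
    apply/eqP; rewrite eq_le v1 /=; apply: (@le_trans _ _ (v k x)).
      rewrite le_min lexx /= -ler_pdivrMr// div1r.
      by apply: ltW; rewrite truncnS_gt.
    by apply: vm; exact: leq_maxr.
  by rewrite vk mulr1; apply: (le_trans gn); apply: gm; exact: leq_maxl.
Qed.

End Cozero.

(** Holds in metrizable spaces; it makes all open sets measurable. *)
Hypothesis cozero_cover : forall W : set Y, open W -> exists u : nat -> Y -> R,
  [/\ forall n, continuous (u n), forall n x, 0 <= u n x &
      W = \bigcup_n [set x | 0 < u n x]].

Lemma daniell_Borel A : Borel A -> daniell.-caratheodory A.
Proof.
have : <<s @open Y >> `<=` daniell.-caratheodory.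
  apply: smallest_sub => [|W /cozero_cover[u [uc u0 ->]]].
    split; first exact: caratheodory_measurable_set0.
    - by move=> B mB; rewrite setTD; exact: caratheodory_measurable_setC.
    - by move=> F; exact: caratheodory_measurable_bigcup.
  by apply: caratheodory_measurable_bigcup => n; exact: daniell_cozero.
exact.
Qed.

(** On an empty space all functions are equal, hence 1 = L 1 = L 0 = 0. *)
Lemma daniell_inhabited : inhabited Y.
Proof.
apply: contrapT => nY; have : (1 : R) = 0.
  rewrite -(L_cst 1) -[RHS]L_cst; congr L; apply/funext => x.
  by case: nY; exists.
by move/eqP; rewrite oner_eq0.
Qed.

Lemma daniell_sigma_additive :
  semi_sigma_additive (daniell : set (borel_type daniell_inhabited) -> \bar R).
Proof.
move=> F mF tF mUF.
pose m :
  {outer_measure set (pointed_by daniell_inhabited) -> \bar R} := daniell.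
apply: (@caratheodory_measure_sigma_additive R _ m) => // [i|].
  exact: (daniell_Borel (mF i)).
exact: (daniell_Borel mUF).
Qed.

Definition daniell_prob : borel_prob R Y :=
  borel_prob_of daniell_set0 daniell_ge0 daniell_sigma_additive daniell_setT.

(** Composing a cover of A with phi gives a cover of the preimage with the same
    bounds. *)
Lemma daniell_preimage (phi : Y -> Y) A : continuous phi ->
  (forall f : Y -> R, continuous f -> L (f \o phi) = L f) ->
  (daniell (phi @^-1` A) <= daniell A)%E.
Proof.
move=> phic Lphi; apply: daniell_ge => a [g [gc g0 gm gA] ga].
apply: daniell_le; exists (fun n => g n \o phi).
  split=> [n x|n x|m n x mn|x /gA//]; [|exact: g0|exact: gm].
  by apply: continuous_comp; [exact: phic|exact: gc].
by move=> n; rewrite Lphi.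
Qed.

End Daniell.

(** * Distance functions and measures on metric spaces *)

Section PseudoDistance.
Variables (R : realType) (T : topologicalType) (rho : T -> T -> R).
Hypotheses (rho0 : forall x y, 0 <= rho x y) (rhoxx : forall x, rho x x = 0).
Variable C : set T.

(** The added 1 keeps the infimum meaningful, and positive, for an empty C. *)
Let dists x : set R := 1 |` [set rho x y | y in C].

Definition dist_to x : R := inf (dists x).

Let dists_ge0 x : lbound (dists x) 0.
Proof. by move=> _ [->|[y _ <-]]. Qed.

Let dists_lb x : has_lbound (dists x).
Proof. by exists 0; exact: dists_ge0. Qed.

Let dists1 x : dists x !=set0.
Proof. by exists 1; left. Qed.

Lemma dist_to_ge0 x : 0 <= dist_to x.
Proof. exact: lb_le_inf. Qed.

Lemma dist_to_eq0 x : C x -> dist_to x = 0.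
Proof.
move=> Cx; apply/eqP; rewrite eq_le dist_to_ge0 andbT -(rhoxx x).
by apply: ge_inf => //; right; exists x.
Qed.

Lemma dist_to_gt0 x e :
  0 < e -> (forall y, C y -> e <= rho x y) -> 0 < dist_to x.
Proof.
move=> e0 Ce; apply: (@lt_le_trans _ _ (Num.min 1 e)).
  by rewrite lt_min ltr01.
apply: lb_le_inf => // _ [->|[y /Ce ye <-]]; first by rewrite ge_min lexx.
by rewrite ge_min ye orbT.
Qed.

Hypothesis rho_sym : forall x y, rho x y = rho y x.
Hypothesis rho_triangle : forall y x z, rho x z <= rho x y + rho y z.
Hypothesis rho_near : forall x e, 0 < e -> \forall y \near x, rho x y < e.

Let dist_to_lip x y : dist_to x - rho x y <= dist_to y.
Proof.
apply: lb_le_inf => // _ [->|[z Cz <-]]; rewrite lerBlDr.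
  apply: (@le_trans _ _ 1); last by rewrite lerDl.
  by apply: ge_inf => //; left.
rewrite addrC; apply: le_trans (rho_triangle y x z).
by apply: ge_inf => //; right; exists z.
Qed.

Lemma dist_to_continuous : continuous dist_to.
Proof.
move=> x; apply/cvgrPdist_lt => e e0; near=> y.
apply: (@le_lt_trans _ _ (rho x y)); last by near: y; exact: rho_near.
have := dist_to_lip x y; have := dist_to_lip y x; rewrite (rho_sym y x).
rewrite ler_norml lerBlDr lerBlDr => ? ?; rewrite lerNl opprB.
by apply/andP; split; lra.
Unshelve. all: by end_near.
Qed.

End PseudoDistance.

Section MetricDistance.
Variables (R : realType) (X : metricType R).

Lemma mdist_near (x : X) (e : R) : 0 < e -> \forall y \near x, mdist x y < e.
Proof.
move=> e0; have := nbhsx_ballx x e e0.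
by rewrite ballEmdist.
Qed.

Lemma closed_zero_set (C : set X) : closed C -> exists u : X -> R,
  [/\ continuous u, forall x, 0 <= u x & C = [set x | u x = 0]].
Proof.
move=> cC; exists (dist_to (@mdist R X) C); split.
- apply: dist_to_continuous.
  + exact: mdist_ge0.
  + exact: metric_sym.
  + by move=> y x z; exact: metric_triangle.
  + exact: mdist_near.
- by move=> x; apply: dist_to_ge0 => ? ?; exact: mdist_ge0.
- apply/seteqP; split=> x /= => [Cx|ux].
    exact: (dist_to_eq0 (@mdist_ge0 R X) (@mdistxx R X) Cx).
  apply: contrapT => nCx.
  have /nbhs_ballP[e /= e0 eC] : nbhs x (~` C).
    by apply: open_nbhs_nbhs; split => //; exact: closed_openC.
  suff : 0 < dist_to (@mdist R X) C x by rewrite ux ltxx.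
  apply: (dist_to_gt0 e0) => y Cy; rewrite leNgt; apply/negP => xy.
  by apply: (eC y) => //; rewrite ballEmdist.
Qed.

Lemma open_Fsigma (U : set X) : open U -> exists V : nat -> set X,
  [/\ forall n, closed (V n), forall m n, (m <= n)%N -> V m `<=` V n &
      U = \bigcup_n V n].
Proof.
move=> oU; have [u [uc u0 UE]] := closed_zero_set (open_closedC oU).
exists (fun n => [set x | n.+1%:R^-1 <= u x]); split.
- move=> n; rewrite -[X in closed X]/(u @^-1` [set r | n.+1%:R^-1 <= r]).
  by apply: preimage_closed; [move=> x _; exact: uc|exact: closed_ge].
- move=> m n mn x /=; apply: le_trans.
  by rewrite lef_pV2 ?posrE// ler_nat.
- rewrite -[U]setCK UE; apply/seteqP; split=> x /= => [/eqP ux|[n _ /= nu] ux].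
    have {}ux : 0 < u x by rewrite lt_neqAle u0 eq_sym ux.
    have [n] := ltr_add_invr ux; rewrite add0r => nu.
    by exists n => //=; exact: ltW.
  by move: nu; rewrite ux leNgt invr_gt0 ltr0Sn.
Qed.

(** The cutoffs max(0, 1 - n u), where u vanishes exactly on C, decrease to the
    indicator of C. *)
Lemma le_closed_of_le_integral (mu : borel_prob R X) (C : set X) (b : \bar R) :
  closed C ->
  (forall f : X -> R, continuous f -> (forall x, 0 <= f x) ->
    (forall x, C x -> 1 <= f x) -> (b <= \int[mu]_x (f x)%:E)%E) ->
  (b <= mu C)%E.
Proof.
move=> cC bf; have [u [uc u0 CE]] := closed_zero_set cC.
pose f n (x : X) := Num.max 0 (1 - n.+1%:R * u x).
have fc n : continuous (f n).
  move=> x.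
  apply: (@continuous_max _ _ (fun=> 0) (fun x => 1 - n.+1%:R * u x)).
    exact: cvg_cst.
  apply: cvgB; first exact: cvg_cst.
  by apply: cvgM; [exact: cvg_cst|exact: uc].
pose V n := [set x | u x < n.+1%:R^-1].
have oV n : open (V n).
  rewrite -[X in open X]/(u @^-1` [set r | r < n.+1%:R^-1]).
  by move/continuousP: uc; apply; exact: open_lt.
have bV n : (b <= mu (V n))%E.
  apply: (@le_trans _ _ (\int[mu]_x (f n x)%:E)%E).
    apply: bf => // x; first by rewrite le_max lexx.
    by rewrite CE /= /f => ->; rewrite mulr0 subr0 le_max lexx orbT.
  have -> : mu (V n) = (\int[mu]_x (\1_(V n) x)%:E)%E.
    by rewrite integral_indic ?setIT//; exact: Borel_open.
  apply: ge0_le_integral => //.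
  - by move=> x _; rewrite lee_fin le_max lexx.
  - by apply/measurable_EFinP; exact: Borel_measurable_fun.
  - by apply/measurable_EFinP; apply: measurable_indic; exact: Borel_open.
  - move=> x _; rewrite lee_fin indicE /f.
    have [Vx|nVx] := boolP (x \in V n).
      by rewrite ge_max ler01 /= gerBl mulr_ge0.
    rewrite ge_max lexx /= subr_le0 -ler_pdivrMl// mulr1 leNgt.
    by apply/negP => ux; move/negP: nVx; apply; rewrite inE.
have CV : C = \bigcap_n V n.
  rewrite CE; apply/seteqP; split=> [x /= ux n _|x Vx /=].
    by rewrite /V /= ux invr_gt0.
  apply/eqP; rewrite eq_le u0 andbT leNgt; apply/negP => ux.
  have [n] := ltr_add_invr ux; rewrite add0r => nu.
  by have := Vx n Logic.I; rewrite /V /= ltNge (ltW nu).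
have Vcvg : mu \o V @ \oo --> mu (\bigcap_n V n).
  apply: (@nonincreasing_cvg_mu _ (borel_type (bp_inhabited mu))).
  - apply: (@le_lt_trans _ _ 1%E); last by rewrite ltry.
    by apply: probability_le1; exact: Borel_open.
  - by move=> n; exact: Borel_open.
  - by rewrite -CV; exact: Borel_closed.
  - move=> m n mn; apply/subsetPset => x; rewrite /V /= => /lt_le_trans; apply.
    by rewrite lef_pV2 ?posrE// ler_nat.
rewrite {1}CV -(cvg_lim _ Vcvg)//; apply: lime_ge.
  by apply/cvg_ex; eexists; exact: Vcvg.
exact: nearW.
Qed.

(** Complements turn the hypothesis into mu <= nu on open sets, and writing an
    open set as an increasing union of closed ones gives nu <= mu there. *)
Lemma borel_prob_eq_of_le_closed (mu nu : borel_prob R X) :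
  (forall C, closed C -> (nu C <= mu C)%E) ->
  forall A, Borel A -> nu A = mu A.
Proof.
move=> numu; apply: borel_prob_unique => U oU; apply/eqP; rewrite eq_le.
apply/andP; split; last first.
  have finU (p : borel_prob R X) : p U = (fine (p U))%:E.
    by rewrite fineK//; apply: fin_num_measure; exact: Borel_open.
  have probC (p : borel_prob R X) : p (~` U) = (1 - p U)%E.
    by apply: probability_setC; exact: Borel_open.
  have := numu _ (open_closedC oU).
  by rewrite !probC (finU mu) (finU nu) -!EFinB !lee_fin; lra.
have [V [cV Vm UV]] := open_Fsigma oU.
have Vcvg : nu \o V @ \oo --> nu (\bigcup_n V n).
  apply: (@nondecreasing_cvg_mu _ (borel_type (bp_inhabited nu))).
  - by move=> n; exact: Borel_closed.
  - by apply: Borel_bigcup => n; exact: Borel_closed.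
  - by move=> m n mn; apply/subsetPset; exact: Vm.
rewrite {1}UV -(cvg_lim _ Vcvg)//; apply: lime_le.
  by apply/cvg_ex; eexists; exact: Vcvg.
apply: nearW => n /=; apply: (le_trans (numu _ (cV n))); apply: bp_le.
- exact: Borel_closed.
- exact: Borel_open.
- by rewrite UV; exact: bigcup_sup.
Qed.

End MetricDistance.

Section ExtensionCozero.
Variables (R : realType) (S : monoidType) (G : groupType).
Variables (eta : {multiplicative S -> G}).
Variables (X : metricType R) (act : S -> X -> X).
Variables (e : nat -> G) (e_surj : forall g, exists n, e n = g).
Local Notation Y := (extension eta act).

(** Finitely many coordinates are compared at a time. The windows exhaust the
    group, so these pseudo-distances together define the topology of the
    extension. *)
Definition window_dist n (x y : Y) : R :=
  \sum_(i < n) mdist (val x (e i)) (val y (e i)).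

Lemma window_dist_ge0 n x y : 0 <= window_dist n x y.
Proof. by apply: sumr_ge0 => i _; exact: mdist_ge0. Qed.

Lemma window_dist_near n x d :
  0 < d -> \forall y \near x, window_dist n x y < d.
Proof.
elim: n d => [|n IH] d d0.
  by near=> y; rewrite /window_dist big_ord0.
near=> y; rewrite /window_dist big_ord_recr /= (splitr d); apply: ltrD.
  by near: y; apply: IH; rewrite divr_gt0.
near: y; have d20 : 0 < d / 2 by rewrite divr_gt0.
have := @extension_coord_continuous _ _ eta _ act (e n) x.
by move=> /(_ _ (mdist_near (val x (e n)) d20)).
Unshelve. all: by end_near.
Qed.

Lemma window_dist_mono m n x y :
  (m <= n)%N -> window_dist m x y <= window_dist n x y.
Proof.
pose d i := mdist (val x (e i)) (val y (e i)).
move=> mn; rewrite /window_dist -!(big_mkord xpredT d).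
rewrite (big_cat_nat (leq0n m) mn) /= lerDl.
by apply: sumr_ge0 => i _; exact: mdist_ge0.
Qed.

Lemma window_nbhs (x : Y) (W : set Y) : nbhs x W ->
  exists n, forall y, window_dist n x y < n.+1%:R^-1 -> W y.
Proof.
pose B n := [set y | window_dist n x y < n.+1%:R^-1].
have BF : Filter (filter_from setT B).
  apply: filter_from_filter; first by exists 0%N.
  move=> m n _ _; exists (maxn m n) => // y By.
  have H k : (k <= maxn m n)%N -> window_dist k x y < k.+1%:R^-1.
    move=> kmn; apply: le_lt_trans (window_dist_mono _ _ kmn) _.
    by apply: (lt_le_trans By); rewrite lef_pV2 ?posrE// ler_nat.
  by split; apply: H; rewrite ?leq_maxl ?leq_maxr.
suff : filter_from setT B --> x by move=> h /h[n _ nW]; exists n.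
apply/(@cvg_initial _ _ (@set_val _ (extension_set eta act)) _ _ BF).
have FF : Filter (@set_val _ (extension_set eta act) @ filter_from setT B).
  exact: fmap_filter.
apply/(cvg_pointwise _ FF) => h; apply/cvg_ballP => d d0.
have [i <-] := e_surj h.
have [n nd] : exists n, n.+1%:R^-1 < d.
  by have [k] := ltr_add_invr d0; rewrite add0r; exists k.
exists (maxn i.+1 n) => // y /= By; rewrite ballEmdist /=.
apply: (@le_lt_trans _ _ (window_dist (maxn i.+1 n) x y)).
  apply: (@le_trans _ _ (window_dist i.+1 x y)); last first.
    by apply: window_dist_mono; rewrite leq_maxl.
  rewrite /window_dist big_ord_recr /= lerDr.
  by apply: sumr_ge0 => j _; exact: mdist_ge0.
apply: (lt_trans By); apply: le_lt_trans nd.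
by rewrite lef_pV2 ?posrE// ler_nat ltnS leq_maxr.
Qed.

(** A point of W stays away from the complement of W for the distance of a
    large enough window. *)
Lemma extension_cozero_cover (W : set Y) : open W -> exists u : nat -> Y -> R,
  [/\ forall n, continuous (u n), forall n x, 0 <= u n x &
      W = \bigcup_n [set x | 0 < u n x]].
Proof.
move=> oW; exists (fun n => dist_to (window_dist n) (~` W)); split.
- move=> n; apply: dist_to_continuous.
  + exact: window_dist_ge0.
  + by move=> x y; apply: eq_bigr => i _; exact: metric_sym.
  + move=> y x z; rewrite -big_split; apply: ler_sum => i _;
      exact: metric_triangle.
  + exact: window_dist_near.
- by move=> n x; apply: dist_to_ge0; exact: window_dist_ge0.
- apply/seteqP; split=> [x Wx|x [n _ /= ux]].
    have [n nW] := window_nbhs (open_nbhs_nbhs (conj oW Wx)).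
    exists n => //=; apply: (@dist_to_gt0 _ _ _ _ _ (n.+1%:R^-1)).
    * by rewrite invr_gt0.
    * by move=> y nWy; rewrite leNgt; apply/negP => /nW.
  apply: contrapT => nWx; move: ux; rewrite dist_to_eq0 ?ltxx//.
  + exact: window_dist_ge0.
  + by move=> y; apply: big1 => i _; rewrite mdistxx.
Qed.

End ExtensionCozero.

(** * Lifting a periodic measure *)

(** Every element is a word in generators and inverses of generators; letters
    are coded by a natural number and a sign. *)
Lemma Sgroup_enum (S : monoidType) (G : groupType)
    (eta : {multiplicative S -> G}) : countable [set: S] -> is_Sgroup eta ->
  exists e : nat -> G, forall g, exists n, e n = g.
Proof.
move=> /countable_injP[f finj] eta_gen.
pose dec (n : nat) : S := if pselect (exists s, f s = n) is left h
  then projT1 (cid h) else 1%g.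
have decK s : dec (f s) = s.
  rewrite /dec; case: pselect => [h|[]]; last by exists s.
  by case: cid => t /= /finj; apply; rewrite inE.
pose letter (p : nat * bool) : G :=
  if p.2 then eta (dec p.1) else (eta (dec p.1))^-1%g.
pose ev (w : seq (nat * bool)) : G := foldr (fun p g => letter p * g)%g 1%g w.
have ev_cat w1 w2 : ev (w1 ++ w2) = (ev w1 * ev w2)%g.
  by elim: w1 => [|p w IH] /=; rewrite ?mul1g// IH mulgA.
exists (fun n => ev (odflt [::] (unpickle n))).
suff H g : exists w, ev w = g.
  by move=> g; have [w <-] := H g; exists (pickle w); rewrite pickleK.
apply: (Sgroup_ind eta_gen (P := fun g => exists w, ev w = g)).
- by exists [::].
- by move=> _ _ [w1 <-] [w2 <-]; exists (w1 ++ w2).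
- move=> _ [w <-]; elim: w => [|[n b] w [w' IH]].
    by exists [::]; rewrite /= invg1.
  exists (w' ++ [:: (n, ~~ b)]); rewrite ev_cat IH /= mulg1 invMg.
  congr (_ * _)%g.
  by rewrite /letter /=; case: b => //=; rewrite invgK.
- by move=> s; exists [:: (f s, true)]; rewrite /= mulg1 /letter /= decK.
Qed.

(** The universal property of a free S-group only concerns targets generated by
    the image of S, so a morphism to an arbitrary finite group is first
    restricted to the subgroup generated by its values. *)
Section Generated.
Variables (S : semigroupType) (gT : finGroupType).
Variable f : {multiplicative S -> gT}.

Definition generated_set : {set gT} :=
  finset (fun x => `[< smallest (@is_subgroup gT) (range f) x >]).

Let gen1 : smallest (@is_subgroup gT) (range f) 1%g.
Proof. by move=> H [[H1 _] _]. Qed.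

Let genM x y : smallest (@is_subgroup gT) (range f) x ->
  smallest (@is_subgroup gT) (range f) y ->
  smallest (@is_subgroup gT) (range f) (x * y)%g.
Proof.
by move=> hx hy H HH; have [[_ [HM _]] _] := HH; apply: HM;
  [exact: hx|exact: hy].
Qed.

Lemma generated_group_set : group_set generated_set.
Proof.
apply/group_setP; split; first by rewrite finset.inE; apply/asboolP.
by move=> x y; rewrite !finset.inE => /asboolP hx /asboolP hy; apply/asboolP;
  exact: genM.
Qed.

Canonical generated_group := Group generated_group_set.

Lemma mem_generated s : f s \in generated_group.
Proof. by rewrite finset.inE; apply/asboolP => H [_]; apply; exists s. Qed.

Definition to_generated (s : S) : [subg generated_group] :=
  subg generated_group (f s).

Lemma to_generatedM : {morph to_generated : s t / (s * t)%g}.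
Proof. by move=> s t; rewrite /to_generated gmulfM subgM ?mem_generated. Qed.

HB.instance Definition _ :=
  isMultiplicative.Build S [subg generated_group] to_generated to_generatedM.

Lemma to_generated_Sgroup : is_Sgroup to_generated.
Proof.
apply/seteqP; split => // x _ H [[H1 [HM HV]] Hf].
(* the image of H in gT is a subgroup containing the values of f, hence it
   contains the whole generated subgroup *)
pose K y := exists2 z : [subg generated_group], H z & val z = y.
have : smallest (@is_subgroup gT) (range f) (val x).
  by have := subgP x; rewrite finset.inE => /asboolP.
move=> /(_ K)[|z Hz /val_inj <- //].
split; last first.
  move=> _ [s _ <-]; exists (to_generated s); first by apply: Hf; exists s.
  by rewrite subgK// mem_generated.
split; [by exists 1%g|split].
- by move=> _ _ [y Hy <-] [z Hz <-]; exists (y * z)%g; [exact: HM|].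
- by move=> _ [y Hy <-]; exists (y^-1)%g; [exact: HV|].
Qed.

End Generated.

Lemma free_Sgroup_lift (S : semigroupType) (G : groupType)
    (gamma : {multiplicative S -> G}) (gT : finGroupType)
    (f : {multiplicative S -> gT}) : is_free_Sgroup gamma ->
  exists theta : {multiplicative G -> gT}, forall s, theta (gamma s) = f s.
Proof.
move=> [_ /(_ _ _ (to_generated_Sgroup f))[theta [thetaE _]]].
have thM : {morph (fun g => sgval (theta g)) : x y / (x * y)%g}.
  by move=> x y; rewrite gmulfM.
pose th := HB.pack_for {multiplicative G -> gT} (fun g => sgval (theta g))
  (isMultiplicative.Build G gT _ thM).
exists th => s; rewrite /th /=.
by have /= -> := thetaE s; rewrite subgK// mem_generated.
Qed.

(** L behaves on continuous functions as the integral against a probability on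
    the natural extension that is invariant and projects below mu, which for
    probabilities amounts to projecting to mu. *)
Definition is_lift (R : realType) (S : monoidType) (G : groupType)
    (gamma : {multiplicative S -> G}) (X : topologicalType) (act : S -> X -> X)
    (mu : borel_prob R X) (L : (extension gamma act -> R) -> R) : Prop :=
  [/\ forall c, L (fun=> c) = c,
      forall f g : extension gamma act -> R, continuous f -> continuous g ->
        L (fun x => f x + g x) = L f + L g,
      forall f g : extension gamma act -> R, continuous f -> continuous g ->
        (forall x, f x <= g x) -> L f <= L g,
      forall g (f : extension gamma act -> R), continuous f ->
        L (f \o extension_shift gamma act g) = L f &
      forall f : X -> R, continuous f -> (forall x, 0 <= f x) ->
        L (f \o extension_proj gamma act) <= \int[mu]_x f x].

Section PeriodicLift.
Variables (R : realType) (X : metricType R) (cX : compact [set: X]).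
Variables (S : monoidType) (act : S -> X -> X).
Hypothesis actc : is_continuous_action act.
Variables (mu : borel_prob R X) (mu_inv : invariant_measures R act mu).
Variables (s0 : seq X) (suppE : measure_support mu = [set` s0]).

Let F : set X := [set` s0].

Let closed_finite (A : set X) : finite_set A -> closed A.
Proof.
apply: (accessible_finite_set_closed.1 _); apply: hausdorff_accessible.
exact: metric_hausdorff.
Qed.

Let finF : finite_set F. Proof. by apply/finite_seqP; exists s0. Qed.

Let Borel1 (x : X) : Borel [set x].
Proof. by apply: Borel_closed; exact: closed_finite. Qed.

Let BorelF : Borel F. Proof. by apply: Borel_closed; exact: closed_finite. Qed.

Let BorelFC : Borel (~` F). Proof. exact: BorelC. Qed.

(** The complement of the support is a countable union of closed sets, each of
    which is null. *)
Lemma support_full : mu (~` F) = 0%E.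
Proof.
have [V [cV _ FV]] := open_Fsigma (closed_openC (closed_finite finF)).
rewrite FV; apply: bp_null_bigcup => n; first exact: Borel_closed.
apply: closed_off_support => //; rewrite suppE -subset0 => x [Vx Fx].
have : (~` F) x by rewrite FV; exists n.
exact.
Qed.

Let w (x : X) : \bar R := mu [set x].

(** The points of a finite support are isolated in it, hence are atoms. *)
Lemma atom_gt0 x : F x -> (0 < w x)%E.
Proof.
move=> Fx; have cFx : closed (F `\ x).
  by apply: closed_finite; exact: finite_setD.
have : measure_support mu x by rewrite suppE.
move=> /(_ (~` (F `\ x)) (closed_openC cFx)) => /(_ _)/lt_le_trans; apply.
  by move=> [_]; apply.
rewrite /w -(bp_setU_null (Borel1 x) BorelFC support_full).
apply: bp_le.
- by apply: BorelC; exact: Borel_closed.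
- by apply: BorelU; [exact: Borel1|exact: BorelFC].
- move=> y nFy; have [Fy|nFyy] := pselect (F y); [left|by right].
  by apply: contrapT => yx; apply: nFy.
Qed.

Let null_off A : Borel A -> (forall x, F x -> ~ A x) -> mu A = 0%E.
Proof.
by move=> bA AF; apply: (bp_null_sub bA BorelFC _ support_full) => x Ax Fx;
  exact: AF Ax.
Qed.

Let Borel_pre s x : Borel (act s @^-1` [set x]).
Proof. by apply: Borel_preimage; [exact: actc.2|exact: Borel1]. Qed.

(** By invariance the image of an atom has at least the mass of the atom. *)
Lemma support_stable s x : F x -> F (act s x).
Proof.
move=> Fx; apply: contrapT => nF.
have := atom_gt0 Fx; rewrite ltNge => /negP; apply.
have <- : w (act s x) = 0%E.
  by apply: null_off => // y Fy /= yE; apply: nF; rewrite -yE.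
rewrite /w -(mu_inv s (Borel1 (act s x))).
apply: bp_le; [exact: Borel1|exact: Borel_pre|by move=> y /= ->].
Qed.

(** By invariance the preimage of an atom is not null, so it meets the
    support. *)
Lemma support_onto s y : F y -> exists2 x, F x & act s x = y.
Proof.
move=> Fy; apply: contrapT => nx.
have := atom_gt0 Fy; rewrite /w -(mu_inv s); last exact: Borel1.
rewrite null_off ?ltxx// => x Fx /= xE; apply: nx; by exists x.
Qed.

Let T := seq_sub s0.

Let FT (t : T) : F (val t). Proof. exact: valP. Qed.

Definition support_map s (t : T) : T := SeqSub (support_stable s (FT t)).

Lemma support_map_inj s : injective (support_map s).
Proof.
have /choice[g gK] (t : T) : exists t', support_map s t' = t.
  have [x Fx xE] := support_onto s (FT t).
  by exists (SeqSub Fx); apply: val_inj.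
exact: (can_inj (canF_sym (gK : cancel g (support_map s)))).
Qed.

(** Products of permutations compose from left to right, so passing from s to
    its permutation reverses products; the inverse restores the order. *)
Definition support_perm s : {perm T} := (perm (@support_map_inj s))^-1%g.

Lemma support_permVE s t : (support_perm s)^-1%g t = support_map s t.
Proof. by rewrite /support_perm invgK permE. Qed.

Lemma support_permM : {morph support_perm : s t / (s * t)%g}.
Proof.
move=> s t; apply: invg_inj; rewrite invMg; apply/permP => x.
rewrite permM !support_permVE; apply: val_inj => /=.
by rewrite actc.1.1.
Qed.

HB.instance Definition _ :=
  isMultiplicative.Build S {perm T} support_perm support_permM.

Lemma atom_support_map s t : w (val (support_map s t)) = w (val t).
Proof.
rewrite /w -(mu_inv s); last exact: Borel1.
have -> : act s @^-1` [set val (support_map s t)] =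
    [set val t] `|` (act s @^-1` [set val (support_map s t)] `\ val t).
  by rewrite setDUK// => x /= ->.
rewrite bp_setU_null//; first by apply: BorelD.
apply: null_off; first exact: BorelD.
move=> x Fx [/= xE]; apply.
suff : SeqSub (Fx : x \in s0) = t by move=> <-.
by apply: (@support_map_inj s); apply: val_inj.
Qed.

Lemma atom_fin x : w x \is a fin_num.
Proof. by apply: fin_num_measure; exact: Borel1. Qed.

Lemma integral_atoms (c : X -> R) : (forall x, 0 <= c x) ->
  (\int[mu]_x (\sum_(t : T) c (val t) * \1_[set val t] x)%:E =
   (\sum_(t : T) c (val t) * fine (w (val t)))%:E)%E.
Proof.
move=> c0; under eq_integral do rewrite -sumEFin.
rewrite ge0_integral_sum//; last 2 first.
- move=> t; apply/measurable_EFinP; apply: measurable_funM => //.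
  by apply: measurable_indic; exact: Borel1.
- by move=> t x _; rewrite lee_fin mulr_ge0.
rewrite -sumEFin; apply: eq_bigr => t _.
under eq_integral do rewrite EFinM.
rewrite ge0_integralZl_EFin//; last first.
  by apply/measurable_EFinP; apply: measurable_indic; exact: Borel1.
rewrite integral_indic//; last exact: Borel1.
by rewrite setIT EFinM fineK// atom_fin.
Qed.

Lemma sum_indic (c : X -> R) x :
  \sum_(t : T) c (val t) * \1_[set val t] x = c x * \1_F x.
Proof.
rewrite [in RHS]indicE; have [Fx|nFx] := boolP (x \in F); last first.
  rewrite mulr0 big1// => t _; rewrite indicE memNset ?mulr0// => /= xt.
  by move/negP: nFx; apply; rewrite xt; apply/mem_set; exact: FT.
have Fx' : x \in s0 by move: Fx; rewrite inE.
rewrite (bigD1 (SeqSub Fx')) //= indicE mem_set// big1 ?addr0// => t tx.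
rewrite indicE memNset ?mulr0// => /= xt; move/eqP: tx; apply.
exact: val_inj.
Qed.

Lemma sum_atoms1 : \sum_(t : T) fine (w (val t)) = 1.
Proof.
apply: EFin_inj; under eq_bigr do rewrite -[fine _]mul1r.
rewrite -(@integral_atoms (fun=> 1))//.
under eq_integral do rewrite (sum_indic (fun=> 1)) mul1r.
rewrite integral_indic// setIT.
apply: (etrans (esym (bp_setU_null BorelF BorelFC support_full))).
by rewrite setUv; exact: bpT.
Qed.

Lemma sum_atoms_le (g : X -> R) : continuous g -> (forall x, 0 <= g x) ->
  ((\sum_(t : T) g (val t) * fine (w (val t)))%:E <= \int[mu]_x (g x)%:E)%E.
Proof.
move=> gc g0; rewrite -integral_atoms//; apply: ge0_le_integral => //.
- by move=> x _; rewrite lee_fin; apply: sumr_ge0 => t _; rewrite mulr_ge0.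
- apply/measurable_EFinP; under eq_fun do rewrite sum_indic.
  apply: measurable_funM; last by apply: measurable_indic; exact: BorelF.
  exact: Borel_measurable_fun.
- by apply/measurable_EFinP; exact: Borel_measurable_fun.
- move=> x _; rewrite lee_fin sum_indic ler_piMr//.
Qed.

Variables (G : groupType) (gamma : {multiplicative S -> G}).
Hypothesis gamma_free : is_free_Sgroup gamma.

(** The functional is the integral against the sum of the atoms of mu, each
    placed at the orbit of its point. *)
Lemma periodic_lift : exists N : (extension gamma act -> R) -> R, is_lift mu N.
Proof.
have [theta thetaE] := free_Sgroup_lift support_perm gamma_free.
have lift_in (t : T) :
    (fun h => val ((theta h)^-1%g t)) \in extension_set gamma act.
  apply/mem_set => s h /=.
  by rewrite gmulfM thetaE invMg permM support_permVE.
(* the orbit of t; theta carries the inverses built into support_perm *)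
pose j (t : T) : extension gamma act :=
  exist (fun y => y \in extension_set gamma act) _ (lift_in t).
have jE g t : extension_shift gamma act g (j t) = j ((theta g)^-1%g t).
  apply: val_inj; apply: funext => h /=.
  by rewrite gmulfM invMg permM.
have theta1 : theta 1%g = 1%g.
  by apply: (mulgI (theta 1%g)); rewrite -gmulfM !mulg1.
have thetaV g : theta g^-1%g = ((theta g)^-1)%g.
  by apply: (mulgI (theta g)); rewrite -gmulfM !mulgV.
pose wt (t : T) := fine (w (val t)).
have wt0 t : 0 <= wt t by rewrite fine_ge0// measure_ge0.
have wtE g : forall t, wt ((theta g)^-1%g t) = wt t.
  apply: (Sgroup_ind gamma_free.1
    (P := fun g => forall t, wt ((theta g)^-1%g t) = wt t))
    => [t|x y hx hy t|x hx t|s t].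
  - by rewrite theta1 invg1 perm1.
  - by rewrite gmulfM invMg permM hx hy.
  - by rewrite thetaV invgK -[LHS]hx permK.
  - by rewrite thetaE support_permVE /wt atom_support_map.
exists (fun f => \sum_(t : T) f (j t) * wt t); split.
- by move=> c; rewrite -mulr_sumr sum_atoms1 mulr1.
- by move=> f g _ _; rewrite -big_split; apply: eq_bigr => t _; rewrite mulrDl.
- by move=> f g _ _ fg; apply: ler_sum => t _; apply: ler_wpM2r.
- move=> g f _; rewrite [RHS](reindex_inj (@perm_inj _ (theta g)^-1%g)) /=.
  by apply: eq_bigr => t _; rewrite jE wtE.
- move=> f fc f0; rewrite -lee_fin fineK; last first.
    rewrite ge0_fin_numE; first exact: integral_lty.
    by apply: integral_ge0 => x _; rewrite lee_fin.
  apply: le_trans (sum_atoms_le fc f0).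
  rewrite lee_fin le_eqVlt; apply/orP; left; apply/eqP; apply: eq_bigr => t _.
  by rewrite /= /extension_proj /= theta1 invg1 perm1.
Qed.

End PeriodicLift.

(** * Lifting a limit of periodic measures *)

Section LimitFunctional.
Variables (R : realType) (X : metricType R) (cX : compact [set: X]).
Variables (S : monoidType) (act : S -> X -> X).
Hypothesis actc : is_continuous_action act.
Variables (G : groupType) (gamma : {multiplicative S -> G}).
Hypothesis gamma_free : is_free_Sgroup gamma.
Local Notation Y := (extension gamma act).

Let compactY : compact [set: Y].
Proof. by apply: compact_extension => //; exact: metric_hausdorff. Qed.

(** Choose a lift for each periodic measure, and pass to the limit along an
    ultrafilter that contains the periodic measures and converges to mu: on a
    continuous function, which is bounded, the values of the lifts stay in a
    compact interval and therefore converge. *)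
Lemma limit_lift (mu : borel_prob R X) :
  closure (periodic_measures R act) mu ->
  exists L : (Y -> R) -> R, is_lift mu L.
Proof.
move=> clmu; have /choice[N NP] (p : borel_prob R X) :
    exists N : (Y -> R) -> R,
    periodic_measures R act p -> is_lift p N.
  have [Pp|nPp] := pselect (periodic_measures R act p).
    have [pinv /finite_seqP[s ps]] := Pp.
    by have [N NP] := periodic_lift cX actc pinv ps gamma_free; exists N.
  by exists (fun=> 0).
have PF : ProperFilter (within (periodic_measures R act) (nbhs mu)).
  exact: within_nbhs_proper.
have [U [UU WU]] := ultraFilterLemma PF.
have UPF : ProperFilter U by exact: ultra_proper.
have UF : Filter U by exact: filter_filter.
have UP : U (periodic_measures R act) by apply: WU; exact: withinT.
have Ucvg : U --> mu by apply: cvg_trans WU _; exact: cvg_within.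
(* on a discontinuous f this may be an arbitrary value *)
pose L (f : Y -> R) := lim ((fun p => N p f) @ U).
have Lcvg (f : Y -> R) : continuous f -> (fun p => N p f) @ U --> L f.
  move=> fc; have cf : compact (range f).
    by apply: continuous_compact; [exact: continuous_subspaceT|exact: compactY].
  have [M [_ Mf]] := compact_bounded cf.
  (* compact_bounded provides the numbers strictly above M *)
  have fM x : `|f x| <= M + 1.
    by apply: (Mf (M + 1)); rewrite ?ltrDl//; exists x.
  have FU := fmap_ultra (fun p => N p f) UU.
  have cI : compact `[- (M + 1), M + 1]%classic := @segment_compact R _ _.
  rewrite compact_ultra in cI.
  have [|l [_ Nl]] := cI _ FU.
    rewrite /fmap /=; apply: filterS UP => p Pp /=.
    have [Nc _ Nle _ _] := NP p Pp.
    rewrite in_itv /= -[X in X <= _ <= _](Nc _) -[X in _ <= _ <= X](Nc (M + 1)).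
    by apply/andP; split; apply: Nle => // x; try exact: cst_continuous;
      have := fM x; rewrite ler_norml => /andP[].
  by apply: cvgP; exact: Nl.
exists L; split.
- move=> c; apply: (lim_near_eq UPF _ (cvg_cst c)).
  by apply: filterS UP => p /NP[Nc _ _ _ _]; exact: Nc.
- move=> f g fc gc; apply: (lim_near_eq UPF _ (cvgD (Lcvg f fc) (Lcvg g gc))).
  by apply: filterS UP => p /NP[_ ND _ _ _]; exact: ND.
- move=> f g fc gc fg; apply: ler_cvg_to (Lcvg f fc) (Lcvg g gc) _.
  by apply: filterS UP => p /NP[_ _ Nle _ _]; exact: Nle.
- move=> g f fc; apply: (lim_near_eq UPF _ (Lcvg f fc)).
  by apply: filterS UP => p /NP[_ _ _ NG _]; exact: NG.
- move=> g gc g0.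
  have int_cvg :
      (fun p : borel_prob R X => \int[p]_x g x) @ U --> \int[mu]_x g x.
    exact: (cvg_borel_prob mu UF).1 Ucvg (mkcts gc).
  apply: ler_cvg_to (Lcvg (g \o extension_proj gamma act) _) int_cvg _.
    by move=> x; apply: continuous_comp;
      [exact: extension_proj_continuous|exact: gc].
  by apply: filterS UP => p /NP[_ _ _ _]; exact.
Qed.

(** The measure built from a lift L of mu projects to mu: on the preimage of a
    closed set C it is at most L (f o pi), hence at most the integral of f, for
    every continuous f >= 0 with f >= 1 on C. *)
Lemma closure_periodic_sub_Ext (S_countable : countable [set: S]) :
  closure (periodic_measures R act) `<=` Ext gamma act R.
Proof.
move=> mu /limit_lift[L [L_cst L_add L_le L_shift L_proj]].
have cY := compactY.
have [e e_surj] := Sgroup_enum S_countable gamma_free.1.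
have coz := @extension_cozero_cover R S G gamma X act e e_surj.
pose nu := daniell_prob cY L_cst L_add L_le coz; exists nu.
  move=> g A bA; apply/eqP; rewrite eq_le.
  have sub h B :
      (daniell L (extension_shift gamma act h @^-1` B) <= daniell L B)%E.
    apply: daniell_preimage; first exact: extension_shift_continuous.
    by move=> f; exact: L_shift.
  apply/andP; split; first exact: sub.
  (* the other inequality is the same one for the inverse of g *)
  apply: le_trans (sub g^-1%g _); rewrite le_eqVlt; apply/orP; left; apply/eqP.
  congr (daniell L _); apply: funext => x /=.
  have [aM a1] := extension_shift_action gamma act.
  by rewrite -aM mulgV a1.
have pic := @extension_proj_continuous _ _ gamma _ act.
move=> A bA; apply/esym.
apply: (borel_prob_eq_of_le_closed (nu := bp_push pic nu)) bA.
move=> C cC.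
change (daniell L (extension_proj gamma act @^-1` C) <= mu C)%E.
apply: le_closed_of_le_integral => // f fc f0 fC.
apply: (@le_trans _ _ (L (f \o extension_proj gamma act))%:E).
  apply: daniell_fun => //.
  - by move=> x; apply: continuous_comp; [exact: pic|exact: fc].
  - by move=> x; exact: f0.
  - by move=> x; exact: fC.
apply: (@le_trans _ _ (\int[mu]_x f x)%:E).
  by rewrite lee_fin; exact: L_proj.
rewrite fineK// ge0_fin_numE; first exact: integral_lty.
by apply: integral_ge0 => x _; rewrite lee_fin.
Qed.

End LimitFunctional.

Theorem theoremB (R : realType) (S : monoidType)
    (S_countable : countable [set: S]) (S_embeddable : embeddable S)
    (Gamma : groupType) (gamma : {multiplicative S -> Gamma})
    (gamma_free : is_free_Sgroup gamma) :
  (forall (X : metricType R) (act : S -> X -> X),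
    compact [set: X] -> is_continuous_action act ->
    (dense_in (invariant_measures R (extension_shift gamma act))
              (periodic_measures R (extension_shift gamma act)) ->
     Ext gamma act R = closure (periodic_measures R act)) /\
    (dense_in (invariant_measures R (extension_shift gamma act))
              (ergodic_periodic_measures R (extension_shift gamma act)) ->
     Ext gamma act R = closure (ergodic_periodic_measures R act))) /\
  (PA R Gamma ->
   (forall A : finType,
      Ext gamma (shift_action S A) R = invariant_measures R (shift_action S A)) ->
   PA R S) /\
  (EPA R Gamma ->
   (forall A : finType,
      Ext gamma (shift_action S A) R = invariant_measures R (shift_action S A)) ->
   EPA R S).
Proof.
have gamma_gen := gamma_free.1.
split; last split.
- move=> X act cX actc; have hX := @metric_hausdorff _ X.
  have le_Ext := closure_periodic_sub_Ext cX actc gamma_free S_countable.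
  split=> dense; apply/seteqP; split => //.
  + exact: Ext_sub_closure_periodic.
  + exact: Ext_sub_closure_ergodic.
  + by apply: subset_trans le_Ext; apply: closureS => mu [].
- by move=> PAG Ext_all; exact: PA_of_Ext Ext_all PAG.
- by move=> EPAG Ext_all; exact: EPA_of_Ext gamma_gen Ext_all EPAG.
Qed.
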